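(* Let $Q\cong\mathbb{Z}^d$, let $Z$ be a free abelian group of finite rank, and let $\{V_n\}_{n\in Z}$ be a numerically constructible family of $Q$-graded $\Bbbk$-vector spaces. (1) The set $T=\{n\in Z\mid \ell(V_n)<\infty\}$ is semisimple, and the function $\ell_V:T\to\mathbb{N}$, $\ell_V(n)=\ell(V_n)$, is piecewise quasipolynomial of degree at most $d$. (2) For any linear function $\lambda:Q\to\mathbb{Z}$, the sets $\mathrm{Top}_\lambda V=\{n\in Z\mid V_n\neq 0 \text{ and } \sup\{\langle\lambda,q\rangle\mid V_{nq}\neq 0\}<\infty\}$ and $\mathrm{soc}_\lambda V=\{n\in Z\mid V_n\neq 0\text{ and }\inf\{\langle\lambda,q\rangle\mid V_{nq}\neq0\}>-\infty\}$ are semisimple, and the functions $\max_{\lambda,V}:\mathrm{Top}_\lambda V\to\mathbb{Z}$, $n\mapsto\max_{V_{nq}\neq0}\langle\lambda,q\rangle$, and $\min_{\lambda,V}:\mathrm{soc}_\lambda V\to\mathbb{Z}$, $n\mapsto\min_{V_{nq}\neq0}\langle\lambda,q\rangle$, are piecewise quasilinear.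
   Context: $\Bbbk$ is a field. A subset $S$ of a finitely generated free abelian group is simple if $S=q+N$ with $N$ the submonoid generated by a (possibly empty) linearly independent set; it is semisimple if it is a finite disjoint union of simple subsets (equivalently, Presburger definable after choosing coordinates). A family $\{V_n\}_{n\in Z}$ with each $V_n=\bigoplus_{q\in Q}V_{nq}$ a $Q$-graded $\Bbbk$-vector space is numerically constructible if $\dim_\Bbbk V_{nq}<\infty$ for all $(n,q)\in Z\times Q$ and $Z\times Q$ can be partitioned into finitely many semisimple subsets on each of which $(n,q)\mapsto\dim_\Bbbk V_{nq}$ is constant. The length of a graded vector space $V=\bigoplus_q V_q$ is $\ell(V)=\sum_q\dim_\Bbbk V_q$. A function $P:Z\to\mathbb{Q}$ on a free abelian group $Z$ of rank $k$ is a quasipolynomial if there are a rank-$k$ sublattice $\Lambda\subseteq Z$ and polynomials $P_{\bar m}\in\mathbb{Q}[x_1,\dots,x_k]$, one for each coset $\bar m\in Z/\Lambda$, with $P(n)=P_{\bar m}(n)$ for $n\in\bar m$. For $T\subseteq Z$, a function $g:T\to\mathbb{Q}$ is piecewise quasipolynomial if there are a finite set $A$, rational convex polyhedra $\Gamma_\alpha$ ($\alpha\in A$) with $Z=\bigcup_\alpha(\Gamma_\alpha\cap Z)$, and quasipolynomials $Q_\alpha$ with $g(n)=Q_\alpha(n)$ for all $n\in\Gamma_\alpha\cap T$; it has degree at most $d$ if all polynomials involved have degree at most $d$, and it is piecewise quasilinear if all these polynomials are linear (degree at most 1). *)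

(* Defs.v *)
From HB Require Import structures.
From mathcomp Require Import all_boot all_order all_algebra.
From mathcomp Require Import mpoly.
From Stdlib Require Import ClassicalEpsilon.

Set Implicit Arguments.
Unset Strict Implicit.
Unset Printing Implicit Defensive.

Import Order.TTheory GRing.Theory Num.Theory.
Local Open Scope ring_scope.

(* A free abelian group of rank k is identified with 'rV[int]_k (a choice
   of coordinates); all notions below are invariant under coordinate change. *)

Definition lin_indep (k r : nat) (g : 'I_r -> 'rV[int]_k) : Prop :=
  forall c : 'I_r -> int, \sum_(i < r) c i *: g i = 0 -> forall i, c i = 0.

Definition simple_subset (k : nat) (S : 'rV[int]_k -> Prop) : Prop :=
  exists (p : 'rV[int]_k) (r : nat) (g : 'I_r -> 'rV[int]_k),
    lin_indep g /\
    forall x, S x <-> exists c : 'I_r -> nat, x = p + \sum_(i < r) g i *+ c i.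

Definition semisimple (k : nat) (S : 'rV[int]_k -> Prop) : Prop :=
  exists (m : nat) (P : 'I_m -> 'rV[int]_k -> Prop),
    (forall i, simple_subset (P i)) /\
    (forall i j x, P i x -> P j x -> i = j) /\
    (forall x, S x <-> exists i, P i x).

(** A family {V_n}_{n in Z} of Q-graded K-vector spaces, Z = Z^k, Q = Z^d,
    with components V n q (finite dimensional: vectType). *)
Definition dimV (K : fieldType) (k d : nat)
  (V : 'rV[int]_k -> 'rV[int]_d -> vectType K) n q : nat :=
  \dim (@fullv K (V n q)).

Definition num_constructible (K : fieldType) (k d : nat)
  (V : 'rV[int]_k -> 'rV[int]_d -> vectType K) : Prop :=
  exists (m : nat) (P : 'I_m -> 'rV[int]_(k + d) -> Prop),
    (forall i, semisimple (P i)) /\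
    (forall i j x, P i x -> P j x -> i = j) /\
    (forall x, exists i, P i x) /\
    (forall i n q n' q', P i (row_mx n q) -> P i (row_mx n' q') ->
        dimV V n q = dimV V n' q').

Definition finite_length (K : fieldType) (k d : nat)
  (V : 'rV[int]_k -> 'rV[int]_d -> vectType K) (n : 'rV[int]_k) : Prop :=
  exists s : seq 'rV[int]_d, forall q, dimV V n q != 0%N -> q \in s.

(** l(V_n) = sum_q dim V_{nq}, computed along a duplicate-free list
    containing all q with V_{nq} <> 0 (meaningful when n is in T). *)
Definition length_of (K : fieldType) (k d : nat)
  (V : 'rV[int]_k -> 'rV[int]_d -> vectType K) (n : 'rV[int]_k) : nat :=
  let s := epsilon (inhabits ([::] : seq 'rV[int]_d))
             (fun s => uniq s /\ forall q, dimV V n q != 0%N -> q \in s) in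
  (\sum_(q <- s) dimV V n q)%N.

Definition Top_set (K : fieldType) (k d : nat)
  (V : 'rV[int]_k -> 'rV[int]_d -> vectType K) (lam : 'rV[int]_d -> int)
  (n : 'rV[int]_k) : Prop :=
  (exists q, dimV V n q != 0%N) /\
  exists M : int, forall q, dimV V n q != 0%N -> lam q <= M.

Definition soc_set (K : fieldType) (k d : nat)
  (V : 'rV[int]_k -> 'rV[int]_d -> vectType K) (lam : 'rV[int]_d -> int)
  (n : 'rV[int]_k) : Prop :=
  (exists q, dimV V n q != 0%N) /\
  exists M : int, forall q, dimV V n q != 0%N -> M <= lam q.

(** max_{lambda,V}(n) and min_{lambda,V}(n) (meaningful on Top / soc). *)
Definition max_lam (K : fieldType) (k d : nat)
  (V : 'rV[int]_k -> 'rV[int]_d -> vectType K) (lam : 'rV[int]_d -> int)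
  (n : 'rV[int]_k) : int :=
  epsilon (inhabits (0 : int))
    (fun m => (exists q, dimV V n q != 0%N /\ lam q = m) /\
              forall q, dimV V n q != 0%N -> lam q <= m).

Definition min_lam (K : fieldType) (k d : nat)
  (V : 'rV[int]_k -> 'rV[int]_d -> vectType K) (lam : 'rV[int]_d -> int)
  (n : 'rV[int]_k) : int :=
  epsilon (inhabits (0 : int))
    (fun m => (exists q, dimV V n q != 0%N /\ lam q = m) /\
              forall q, dimV V n q != 0%N -> m <= lam q).

Definition in_lattice (k : nat) (L : 'M[int]_k) (x : 'rV[int]_k) : Prop :=
  exists c : 'rV[int]_k, x = c *m L.

(** Quasipolynomial on Z^k all of whose polynomials have degree <= deg:
    a rank-k sublattice Lambda (rows of L, det L <> 0) and one polynomial
    P_m per coset (P constant on cosets of Lambda). *)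
Definition quasipoly_deg (k deg : nat) (F : 'rV[int]_k -> rat) : Prop :=
  exists (L : 'M[int]_k) (P : 'rV[int]_k -> {mpoly rat[k]}),
    \det L != 0 /\
    (forall n n', in_lattice L (n - n') -> P n = P n') /\
    (forall n, (msize (P n) <= deg.+1)%N) /\
    (forall n, F n = (P n).@[fun i => (n 0 i)%:~R]).

Definition in_polyhedron (k m : nat) (A : 'M[rat]_(m, k)) (b : 'cV[rat]_m)
  (n : 'rV[int]_k) : Prop :=
  forall i, \sum_(j < k) A i j * (n 0 j)%:~R <= b i 0.

Definition piecewise_quasipoly (k deg : nat) (T : 'rV[int]_k -> Prop)
  (g : 'rV[int]_k -> rat) : Prop :=
  exists (a : nat) (m : 'I_a -> nat)
         (A : forall al : 'I_a, 'M[rat]_(m al, k))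
         (b : forall al : 'I_a, 'cV[rat]_(m al))
         (F : 'I_a -> 'rV[int]_k -> rat),
    (forall n, exists al, in_polyhedron (A al) (b al) n) /\
    (forall al, quasipoly_deg deg (F al)) /\
    (forall al n, in_polyhedron (A al) (b al) n -> T n -> g n = F al n).

Definition piecewise_quasilinear (k : nat) (T : 'rV[int]_k -> Prop)
  (g : 'rV[int]_k -> rat) : Prop := piecewise_quasipoly 1 T g.

(* Main.v *)
(** Semisimple sets are the Presburger definable ones, so everything reduces to eliminating one
    integer variable [t] from a quantifier-free Presburger description. Cut the space into finitely
    many atoms, on which the signs of the given affine forms and the residues modulo [N] of the
    coordinates are constant. The fibre of an atom over [x] is either empty or an arithmetic
    progression [{t0 + N s | L x <= s <= U x}] with piecewise quasilinear (possibly infinite) bounds.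
    Hence Presburger sets are closed under projection; an extremal value is [t0 + N L x], so it is
    piecewise quasilinear; and summing a polynomial over the fibre through a discrete antiderivative
    raises its degree by one, so that [d] summations give degree [d]. Conversely, by induction on the
    dimension a Presburger set is a disjoint union of sets lying between two affine functions over a
    simple base, and those are cut explicitly into simple sets. *)

Require Import Defs.
From HB Require Import structures.
From mathcomp Require Import all_boot all_order all_algebra.
From mathcomp Require Import mpoly zify ring.
From Stdlib Require Import Classical ClassicalEpsilon.
From Stdlib Require Import FunctionalExtensionality PropExtensionality.

Set Implicit Arguments.
Unset Strict Implicit.
Unset Printing Implicit Defensive.

Import Order.TTheory GRing.Theory Num.Theory.
Local Open Scope ring_scope.

(** * Presburger sets and piecewise polynomial functions *)

(** The obstacle is the demand for disjoint pieces with linearly independent generators. The region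
    between two affine functions over a simple base is usually not simplicial, so it has to be cut;
    disjointness of the coarser pieces is free, because atoms are the classes of an equivalence
    relation of finite index ([same_atom_key]). The end points of a fibre come from integer
    division, hence are affine with rational coefficients on each leaf of a decision tree, and a
    leaf is integral only where the tree uses it. Therefore values live in [rat], substitution
    carries a premise [z%:~R = h x], and integrality is stated relative to a set. The bound [d] on
    the degree comes out because the dimension is a step function, of degree 0, and evaluating an
    antiderivative at end points of degree 1 does not raise its degree again. Summation never
    decides finiteness: its conclusion is conditional on a list that enumerates the fibre. Finite
    length and boundedness are expressed instead by a bound held in one more variable, which is then
    quantified. *)

(* Points are valuations of infinitely many variables, so that eliminating or introducing a variable
   never changes the ambient type; [Z^k] enters through [toenv] below. *)
Definition env := nat -> int.

Definition upd (x : env) (i : nat) (t : int) : env :=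
  fun j => if j == i then t else x j.

Lemma updE x i t : upd x i t i = t.
Proof. by rewrite /upd eqxx. Qed.

Lemma upd_upd x i s t : upd (upd x i s) i t = upd x i t.
Proof. by apply: functional_extensionality => j; rewrite /upd; case: eqP. Qed.

Inductive affine : (env -> int) -> Prop :=
| affine_const c : affine (fun => c)
| affine_var c i : affine (fun x => c * x i)
| affine_add f g : affine f -> affine g -> affine (fun x => f x + g x).

Lemma affine_ext f g : f =1 g -> affine f -> affine g.
Proof. by move=> /functional_extensionality ->. Qed.

Lemma affineZ c f : affine f -> affine (fun x => c * f x).
Proof.
elim=> {f} [b|b i|f g _ IHf _ IHg]; first exact: affine_const.
  by apply: affine_ext (affine_var (c * b) i) => x; rewrite mulrA.
by apply: affine_ext (affine_add IHf IHg) => x; rewrite mulrDr.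
Qed.

Lemma affine_proj i : affine (fun x => x i).
Proof. by apply: affine_ext (affine_var 1 i) => x; rewrite mul1r. Qed.

Lemma affineB f g : affine f -> affine g -> affine (fun x => f x - g x).
Proof.
by move=> af /(affineZ (-1)) ag; apply: affine_ext (affine_add af ag) => x; rewrite mulN1r.
Qed.

Lemma affine_sum (I : Type) (r : seq I) (f : I -> env -> int) :
  (forall i, affine (f i)) -> affine (fun x => \sum_(i <- r) f i x).
Proof.
move=> af; elim: r => [|i r IH].
  by apply: affine_ext (affine_const 0) => x; rewrite big_nil.
by apply: affine_ext (affine_add (af i) IH) => x; rewrite big_cons.
Qed.

Lemma affine_upd f i : affine f ->
  exists c g, affine g /\ forall x t, f (upd x i t) = g x + c * t.
Proof.
elim=> {f} [c|c l|f g _ [a [f' [af ef]]] _ [b [g' [ag eg]]]].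
- exists 0, (fun=> c); split; first exact: affine_const.
  by move=> x t; rewrite mul0r addr0.
- case: (altP (l =P i)) => [->|ne].
    exists c, (fun=> 0); split; first exact: affine_const.
    by move=> x t; rewrite updE add0r.
  exists 0, (fun x => c * x l); split; first exact: affine_var.
  by move=> x t; rewrite /upd (negPf ne) mul0r addr0.
exists (a + b), (fun x => f' x + g' x); split; first exact: affine_add.
by move=> x t; rewrite ef eg mulrDl addrACA.
Qed.

(** Quantifiers are absent on purpose: an induction over this predicate sees only signs of affine
    forms and divisibilities, and closure under projection is derived later as [presburger_ex]. *)
Inductive presburger : (env -> Prop) -> Prop :=
| presburger_ge f : affine f -> presburger (fun x => 0 <= f x)
| presburger_dvd f (N : nat) : affine f -> (0 < N)%N -> presburger (fun x => (N %| f x)%Z)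
| presburger_not S : presburger S -> presburger (fun x => ~ S x)
| presburger_and S T : presburger S -> presburger T -> presburger (fun x => S x /\ T x).

Lemma presburger_ext S T : (forall x, S x <-> T x) -> presburger S -> presburger T.
Proof.
move=> e; suff -> : S = T by [].
by apply: functional_extensionality => x; apply: propositional_extensionality.
Qed.

Lemma presburger_const (P : Prop) : presburger (fun=> P).
Proof.
have T : presburger (fun=> True).
  by apply: presburger_ext (presburger_ge (affine_const 0)).
case: (classic P) => p; first by apply: presburger_ext T.
by apply: presburger_ext (presburger_not T) => x; tauto.
Qed.

Lemma presburger_or S T : presburger S -> presburger T -> presburger (fun x => S x \/ T x).
Proof.
move=> dS dT; apply: presburger_ext (presburger_not (presburger_and (presburger_not dS) (presburger_not dT))) => x.
by split=> [/not_and_or[/NNPP|/NNPP]|]; tauto.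
Qed.

Lemma presburger_imp S T : presburger S -> presburger T -> presburger (fun x => S x -> T x).
Proof.
move=> dS dT; apply: presburger_ext (presburger_or (presburger_not dS) dT) => x.
by case: (classic (S x)); tauto.
Qed.

Lemma presburger_le f g : affine f -> affine g -> presburger (fun x => f x <= g x).
Proof.
by move=> af ag; apply: presburger_ext (presburger_ge (affineB ag af)) => x; rewrite subr_ge0.
Qed.

Lemma presburger_eq f g : affine f -> affine g -> presburger (fun x => f x = g x).
Proof.
move=> af ag; apply: presburger_ext (presburger_and (presburger_le af ag) (presburger_le ag af)) => x.
by split=> [[h1 h2]|->] //; apply/le_anti/andP.
Qed.

Lemma presburger_all (I : eqType) (r : seq I) (S : I -> env -> Prop) :
  (forall i, presburger (S i)) -> presburger (fun x => forall i, i \in r -> S i x).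
Proof.
move=> dS; elim: r => [|i r IH]; first by apply: presburger_ext (presburger_const True).
apply: presburger_ext (presburger_and (dS i) IH) => x; split=> [[h1 h2] j|h].
  by rewrite inE => /orP[/eqP ->|/h2].
by split=> [|j jr]; apply: h; rewrite inE ?eqxx ?jr ?orbT.
Qed.

Lemma presburger_allT (I : finType) (S : I -> env -> Prop) :
  (forall i, presburger (S i)) -> presburger (fun x => forall i, S i x).
Proof.
move=> dS; apply: presburger_ext (presburger_all (enum I) dS) => x.
by split=> h i *; apply: h; rewrite ?mem_enum.
Qed.

Lemma presburger_exT (I : finType) (S : I -> env -> Prop) :
  (forall i, presburger (S i)) -> presburger (fun x => exists i, S i x).
Proof.
move=> dS; apply: presburger_ext (presburger_not (presburger_allT (fun i => presburger_not (dS i)))) => x.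
by split=> [/not_all_not_ex|[i Si] /(_ i)].
Qed.

(** * Polynomial functions with a bound on the degree, and their discrete antiderivatives *)

Inductive polyfun : nat -> (env -> rat) -> Prop :=
| polyfun_const c : polyfun 0 (fun => c)
| polyfun_add e f g : polyfun e f -> polyfun e g -> polyfun e (fun x => f x + g x)
| polyfun_mulX e f i : polyfun e f -> polyfun e.+1 (fun x => (x i)%:~R * f x)
| polyfun_S e f : polyfun e f -> polyfun e.+1 f.

Lemma polyfun_ext e f g : f =1 g -> polyfun e f -> polyfun e g.
Proof. by move=> /functional_extensionality ->. Qed.

Lemma polyfun_cst e c : polyfun e (fun=> c).
Proof. by elim: e => [|e]; [exact: polyfun_const|exact: polyfun_S]. Qed.

Lemma polyfunZ e c f : polyfun e f -> polyfun e (fun x => c * f x).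
Proof.
elim=> {e f} [b|e f g _ IHf _ IHg|e f i _ IH|e f _ IH]; first exact: polyfun_const.
- by apply: polyfun_ext (polyfun_add IHf IHg) => x; rewrite mulrDr.
- by apply: polyfun_ext (polyfun_mulX i IH) => x; rewrite mulrCA.
- exact: polyfun_S.
Qed.

Lemma polyfun_aff f : affine f -> polyfun 1 (fun x => (f x)%:~R).
Proof.
elim=> {f} [b|b i|f g _ IHf _ IHg]; first exact: polyfun_cst.
  by apply: polyfun_ext (polyfunZ b%:~R (polyfun_mulX i (polyfun_const 1))) => x; rewrite mulr1 rmorphM.
by apply: polyfun_ext (polyfun_add IHf IHg) => x; rewrite rmorphD.
Qed.

(** Clearing denominators reduces signs and floors of degree 1 functions to those of integer affine
    forms. The first conjunct serves the induction: in the product case the cofactor has degree 0,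
    and being a constant it keeps the product affine. *)
Lemma polyfun1_clear e f : polyfun e f -> (e <= 1)%N ->
  (e = 0 -> exists c, f = fun=> c) /\
  exists2 M : nat, (0 < M)%N & exists2 g, affine g & forall x, M%:R * f x = (g x)%:~R.
Proof.
elim=> {e f} [c|e f g _ IHf _ IHg|e f i _ IH|e f _ IH] le1.
- split=> [_|]; first by exists c.
  exists `|denq c|%N; first by rewrite absz_gt0 denq_neq0.
  exists (fun=> numq c); first exact: affine_const.
  by move=> _; rewrite numqE pmulrn absz_denq mulrC.
- have [cf [M Mp [f' af ef]]] := IHf le1; have [cg [N Np [g' ag eg]]] := IHg le1.
  split=> [e0|].
    by have [[a ->] [b ->]] := (cf e0, cg e0); exists (a + b).
  exists (M * N)%N; first by rewrite muln_gt0 Mp.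
  exists (fun x => N%:Z * f' x + M%:Z * g' x); first by apply: affine_add; exact: affineZ.
  by move=> x; rewrite rmorphD !rmorphM /= -ef -eg -!pmulrn; ring.
- have [cf _] := IH (ltnW le1).
  have [|c ->] := cf _; first by lia.
  split=> //.
  exists `|denq c|%N; first by rewrite absz_gt0 denq_neq0.
  exists (fun x => numq c * x i); first exact: affine_var.
  by move=> x; rewrite rmorphM /= numqE pmulrn absz_denq; ring.
- have [_ [M Mp H]] := IH (ltnW le1).
  by split=> //; exists M.
Qed.

Lemma polyfunM e e' f g : polyfun e f -> polyfun e' g -> polyfun (e + e') (fun x => f x * g x).
Proof.
move=> pf pg; elim: pf => {e f} [c|e f f' _ IHf _ IHf'|e f i _ IH|e f _ IH].
- exact: polyfunZ.
- by apply: polyfun_ext (polyfun_add IHf IHf') => x; rewrite mulrDl.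
- by rewrite addSn; apply: polyfun_ext (polyfun_mulX i IH) => x; rewrite mulrA.
- exact: polyfun_S.
Qed.

(** [upd] accepts integers only while [h] is rational-valued, hence the premise on [z]: the
    substitution is meaningful just where [h] happens to be integral. *)
Lemma polyfun_subst e f h i : polyfun e f -> polyfun 1 h ->
  exists2 f', polyfun e f' & forall x z, z%:~R = h x -> f (upd x i z) = f' x.
Proof.
move=> pf ph; elim: pf => {e f} [c|e f g _ [f' pf ef] _ [g' pg eg]|e f l _ [f' pf ef]|e f _ [f' pf ef]].
- by exists (fun=> c) => //; exact: polyfun_const.
- exists (fun x => f' x + g' x); first exact: polyfun_add.
  by move=> x z e0; rewrite (ef _ _ e0) (eg _ _ e0).
- case: (altP (l =P i)) => [->|ne].
    exists (fun x => h x * f' x); first by rewrite -add1n; exact: polyfunM.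
    by move=> x z e0; rewrite updE e0 (ef _ _ e0).
  exists (fun x => (x l)%:~R * f' x); first exact: polyfun_mulX.
  by move=> x z e0; rewrite {1}/upd (negPf ne) (ef _ _ e0).
- by exists f' => //; exact: polyfun_S.
Qed.

(** The falling factorial t (t - 1) ... (t - j + 1); its forward difference is j times the previous
    one, so it plays the part of a power under summation. *)
Definition ffact_rat (j : nat) (t : int) : rat := \prod_(a < j) (t%:~R - a%:R).

Lemma ffact_ratS j t : ffact_rat j.+1 t = ffact_rat j t * (t%:~R - j%:R).
Proof. by rewrite /ffact_rat big_ord_recr. Qed.

Lemma ffact_ratSl j t : ffact_rat j.+1 (t + 1) = (t%:~R + 1) * ffact_rat j t.
Proof.
rewrite /ffact_rat big_ord_recl subr0 rmorphD /=; congr (_ * _).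
by apply: eq_bigr => a _; rewrite /bump add1n -natr1; ring.
Qed.

Lemma polyfun_ffact j i : polyfun j (fun x => ffact_rat j (x i)).
Proof.
elim: j => [|j IH].
  by apply: polyfun_ext (polyfun_const 1) => x; rewrite /ffact_rat big_ord0.
have p1 : polyfun 1 (fun x => (x i)%:~R + - j%:R).
  apply: polyfun_add (polyfun_cst _ _).
  exact: (polyfun_aff (affine_proj i)).
rewrite -addn1; apply: polyfun_ext (polyfunM IH p1) => x; by rewrite addn1 ffact_ratS.
Qed.

(* Carrying the falling factorial makes the induction go through: [t * t^_j = t^_(j+1) + j * t^_j]. *)
Lemma polyfun_antidiff_ffact i e f : polyfun e f -> forall j,
  exists2 G, polyfun (e + j).+1 G &
    forall x t, G (upd x i (t + 1)) - G (upd x i t) = f (upd x i t) * ffact_rat j t.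
Proof.
elim=> {e f} [c|e f g _ IHf _ IHg|e f l _ IH|e f _ IH] j.
- exists (fun x => c / j.+1%:R * ffact_rat j.+1 (x i)).
    by apply: polyfunZ; exact: polyfun_ffact.
  move=> x t; rewrite !updE -mulrBr ffact_ratSl ffact_ratS.
  have nz : j.+1%:R != 0 :> rat by rewrite pnatr_eq0.
  rewrite -natr1 in nz *.
  by field.
- have [[F pF eF] [G pG eG]] := (IHf j, IHg j).
  exists (fun x => F x + G x); first exact: polyfun_add.
  by move=> x t; rewrite mulrDl -eF -eG; ring.
- case: (altP (l =P i)) => [->|ne].
    have [[F pF eF] [G pG eG]] := (IH j.+1, IH j).
    exists (fun x => F x + j%:R * G x).
      rewrite addnS in pF; apply: polyfun_add => //.
      by apply: polyfunZ; exact: polyfun_S.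
    move=> x t; rewrite updE.
    have -> : t%:~R * f (upd x i t) * ffact_rat j t =
      f (upd x i t) * ffact_rat j.+1 t + j%:R * (f (upd x i t) * ffact_rat j t).
      by rewrite ffact_ratS; ring.
    by rewrite -eF -eG; ring.
  have [G pG eG] := IH j.
  exists (fun x => (x l)%:~R * G x); first by rewrite addSn; exact: polyfun_mulX.
  by move=> x t; rewrite -mulrA -eG {1 3 5}/upd (negPf ne); ring.
- have [G pG eG] := IH j.
  by exists G => //; rewrite addSn; exact: polyfun_S.
Qed.

Lemma polyfun_antidiff i e f : polyfun e f ->
  exists2 G, polyfun e.+1 G &
    forall x t, G (upd x i (t + 1)) - G (upd x i t) = f (upd x i t).
Proof.
move=> /polyfun_antidiff_ffact - /(_ i 0)[G pG eG].
exists G; first by rewrite addn0 in pG.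
by move=> x t; rewrite eG /ffact_rat big_ord0 mulr1.
Qed.

(* A function given by a decision tree with Presburger tests and polynomials at the leaves. *)
Inductive pwpoly (e : nat) : (env -> rat) -> Prop :=
| pwpoly_poly h : polyfun e h -> pwpoly e h
| pwpoly_if D g1 g2 g : presburger D -> pwpoly e g1 -> pwpoly e g2 ->
    (forall x, D x -> g x = g1 x) -> (forall x, ~ D x -> g x = g2 x) -> pwpoly e g.

Lemma pwpoly_ext e f g : f =1 g -> pwpoly e f -> pwpoly e g.
Proof. by move=> /functional_extensionality ->. Qed.

Lemma pwpoly_map e e' (phi : env -> rat -> rat) g :
  (forall h, polyfun e h -> pwpoly e' (fun x => phi x (h x))) -> pwpoly e g ->
  pwpoly e' (fun x => phi x (g x)).
Proof.
move=> H; elim=> {g} [h /H //|D g1 g2 g dD _ IH1 _ IH2 e1 e2].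
by apply: (pwpoly_if dD IH1 IH2) => [x /e1|x /e2] ->.
Qed.

Lemma pwpoly_map2 e1 e2 e' (phi : env -> rat -> rat -> rat) g1 g2 :
  (forall h1 h2, polyfun e1 h1 -> polyfun e2 h2 -> pwpoly e' (fun x => phi x (h1 x) (h2 x))) ->
  pwpoly e1 g1 -> pwpoly e2 g2 -> pwpoly e' (fun x => phi x (g1 x) (g2 x)).
Proof.
move=> H P1 P2; apply: (pwpoly_map (e := e1) (phi := fun x u => phi x u (g2 x))) => // h ph.
by apply: (pwpoly_map (e := e2) (phi := fun x v => phi x (h x) v)) => // h' ph'; apply: H.
Qed.

Lemma pwpoly_add e f g : pwpoly e f -> pwpoly e g -> pwpoly e (fun x => f x + g x).
Proof.
by apply: (pwpoly_map2 (phi := fun _ u v => u + v)) => *; apply: pwpoly_poly; exact: polyfun_add.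
Qed.

Lemma pwpolyZ e c g : pwpoly e g -> pwpoly e (fun x => c * g x).
Proof.
by apply: (pwpoly_map (phi := fun _ u => c * u)) => *; apply: pwpoly_poly; exact: polyfunZ.
Qed.

Lemma pwpoly_const e c : pwpoly e (fun=> c).
Proof. by apply: pwpoly_poly; exact: polyfun_cst. Qed.

Lemma pwpoly_sum e (I : Type) (r : seq I) (f : I -> env -> rat) :
  (forall i, pwpoly e (f i)) -> pwpoly e (fun x => \sum_(i <- r) f i x).
Proof.
move=> Pf; elim: r => [|i r IH].
  by apply: pwpoly_ext (pwpoly_const _ 0) => x; rewrite big_nil.
by apply: pwpoly_ext (pwpoly_add (Pf i) IH) => x; rewrite big_cons.
Qed.

(** The sets [D i] may overlap: [g] follows the first one, in the order of [enum I], that contains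
    the point. *)
Lemma pwpoly_choose e (I : finType) (D : I -> env -> Prop) (h : I -> env -> rat) :
  (forall i, presburger (D i)) -> (forall i, pwpoly e (h i)) ->
  exists2 g, pwpoly e g & forall x, (exists i, D i x) -> exists2 i, D i x & g x = h i x.
Proof.
move=> dD Ph.
suff [g Pg H] : exists2 g, pwpoly e g & forall x, (exists2 i, i \in enum I & D i x) ->
    exists2 i, D i x & g x = h i x.
  by exists g => // x [i Di]; apply: H; exists i; rewrite ?mem_enum.
elim: (enum I) => [|i r [g' Pg' IH]]; first by exists (fun=> 0); [exact: pwpoly_const|move=> x []].
pose g x := if excluded_middle_informative (D i x) then h i x else g' x.
exists g.
  by apply: (pwpoly_if (dD i) (Ph i) Pg') => x; rewrite /g; case: excluded_middle_informative.
move=> x [j jr Dj]; rewrite /g; case: excluded_middle_informative => [?|n]; first by exists i.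
by apply: IH; exists j => //; move: jr; rewrite inE => /orP[/eqP ji|//]; case: n; rewrite -ji.
Qed.

Lemma pwpoly_cases e (I : finType) (D : I -> env -> Prop) (h : I -> env -> rat) g :
  (forall i, presburger (D i)) -> (forall i, pwpoly e (h i)) ->
  (forall i x, D i x -> g x = h i x) -> (forall x, exists i, D i x) -> pwpoly e g.
Proof.
move=> dD Ph gh cov; have [g' Pg' H] := pwpoly_choose dD Ph.
by apply: pwpoly_ext Pg' => x; have [i Di ->] := H x (cov x); rewrite (gh i).
Qed.

Lemma presburger_pwpoly_ge0 g : pwpoly 1 g -> presburger (fun x => 0 <= g x).
Proof.
elim=> {g} [h /polyfun1_clear[]// _ [M M0 [f af ef]]|D g1 g2 g dD _ IH1 _ IH2 e1 e2].
  apply: presburger_ext (presburger_ge af) => x.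
  by rewrite -(@ler0z rat) -ef pmulr_rge0 // ltr0n.
apply: presburger_ext (presburger_or (presburger_and dD IH1) (presburger_and (presburger_not dD) IH2)) => x.
case: (classic (D x)) => Dx; first by rewrite (e1 _ Dx); tauto.
by rewrite (e2 _ Dx); tauto.
Qed.

(** * Integer-valued piecewise linear functions: maximum, minimum and division *)

Definition pwlinear (g : env -> int) := pwpoly 1 (fun x => (g x)%:~R).

Lemma pwlinear_aff f : affine f -> pwlinear f.
Proof. by move=> /polyfun_aff/pwpoly_poly. Qed.

Lemma pwlinear_add f g : pwlinear f -> pwlinear g -> pwlinear (fun x => f x + g x).
Proof. by move=> Pf Pg; apply: pwpoly_ext (pwpoly_add Pf Pg) => x; rewrite rmorphD. Qed.

Lemma pwlinearZ c f : pwlinear f -> pwlinear (fun x => c * f x).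
Proof. by move=> Pf; apply: pwpoly_ext (pwpolyZ c%:~R Pf) => x; rewrite rmorphM. Qed.

Lemma presburger_pwlinear_le f g : pwlinear f -> pwlinear g -> presburger (fun x => f x <= g x).
Proof.
move=> Pf Pg; apply: presburger_ext (presburger_pwpoly_ge0 (pwlinear_add Pg (pwlinearZ (-1) Pf))) => x.
by rewrite ler0z mulN1r subr_ge0.
Qed.

Lemma pwlinear_max f g : pwlinear f -> pwlinear g -> pwlinear (fun x => Num.max (f x) (g x)).
Proof.
move=> Pf Pg; apply: (pwpoly_if (presburger_pwlinear_le Pf Pg) Pg Pf) => x; first by move=> /max_idPr ->.
by move=> /negP; rewrite -ltNge => /ltW/max_idPl ->.
Qed.

Lemma pwlinear_min f g : pwlinear f -> pwlinear g -> pwlinear (fun x => Num.min (f x) (g x)).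
Proof.
move=> Pf Pg; apply: (pwpoly_if (presburger_pwlinear_le Pf Pg) Pf Pg) => x; first by move=> /min_idPl ->.
by move=> /negP; rewrite -ltNge => /ltW/min_idPr ->.
Qed.

(** On the Presburger set where f = r modulo m the quotient is (f - r) / m, of degree 1, and there
    are only m residues. *)
Lemma pwlinear_aff_div f (m : nat) : (0 < m)%N -> affine f -> pwlinear (fun x => (f x %/ m)%Z).
Proof.
move=> m0 af.
have mz : m%:Z != 0 by rewrite eqz_nat -lt0n.
apply: (pwpoly_cases (D := fun (r : 'I_m) x => (m %| f x - r%:Z)%Z)
   (h := fun r x => (m%:R)^-1 * ((f x)%:~R + - r%:R))).
- by move=> r; apply: presburger_dvd => //; apply: affineB => //; exact: affine_const.
- by move=> r; apply: pwpolyZ; apply: pwpoly_add (pwpoly_const _ _); exact: pwlinear_aff.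
- move=> r x /dvdzP[q e]; have -> : f x = q * m + r by rewrite -e subrK.
  rewrite divzMDl // divz_small ?ltz_nat /= ?ltn_ord // addr0.
  have mr : m%:R != 0 :> rat by rewrite pnatr_eq0 -lt0n.
  by rewrite rmorphD rmorphM /= -!pmulrn addrK mulrCA mulVf ?mulr1.
- move=> x; have lt : (`|(f x %% m)%Z| < m)%N.
    by rewrite -ltz_nat gez0_abs ?modz_ge0 // ltz_pmod.
  exists (Ordinal lt); rewrite /= gez0_abs ?modz_ge0 //.
  by rewrite {1}(divz_eq (f x) m) addrK dvdz_mull.
Qed.

Lemma floor_div (a : int) (m : nat) : (0 < m)%N ->
  Num.floor (a%:~R / m%:R : rat) = (a %/ m)%Z.
Proof.
move=> m0; have mr : 0 < m%:R :> rat by rewrite ltr0n.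
apply: floor_def; rewrite ler_pdivlMr // ltr_pdivrMr // pmulrn -!rmorphM /= ler_int ltr_int.
have mz : m%:Z != 0 by rewrite eqz_nat -lt0n.
by rewrite lez_floor //= ltz_ceil.
Qed.

Lemma pwlinear_div f (m : nat) : (0 < m)%N -> pwlinear f -> pwlinear (fun x => (f x %/ m)%Z).
Proof.
move=> m0 Pf.
(* A leaf of the tree need not be integral at every point, so integer division is first rewritten as
   the floor of a rational quotient, which makes sense on every leaf. *)
apply: (@pwpoly_ext _ (fun x => (Num.floor ((f x)%:~R / m%:R : rat))%:~R)).
  by move=> x; rewrite floor_div.
apply: (pwpoly_map (phi := fun _ u => (Num.floor (u / m%:R : rat))%:~R)) Pf => h.
case/polyfun1_clear=> // _ [M M0 [g ag eg]].
have Mm : (0 < M * m)%N by rewrite muln_gt0 M0.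
apply: pwpoly_ext (pwlinear_aff_div Mm ag) => x; congr (_%:~R).
rewrite -floor_div // -eg natrM; congr Num.floor.
by field; rewrite !pnatr_eq0 -!lt0n m0.
Qed.

Definition affine_form := {f : env -> int | affine f}.

(* [x] and [y] lie in the same atom; only the first [n] coordinates are reduced modulo [N]. *)
Definition same_atom (A : seq affine_form) (N n : nat) (x y : env) : Prop :=
  all (fun f => (0 <= sval f x) == (0 <= sval f y)) A /\
  forall l, (l < n)%N -> (N %| x l - y l)%Z.

Lemma same_atom_sym A N n x y : same_atom A N n x y -> same_atom A N n y x.
Proof.
case=> a b; split; last by move=> l /b; rewrite -opprB rpredN.
by apply: sub_all a => f; rewrite eq_sym.
Qed.

Lemma same_atom_cat A N n B M m x y : same_atom (A ++ B) (N * M) (maxn n m) x y ->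
  same_atom A N n x y /\ same_atom B M m x y.
Proof.
case; rewrite all_cat => /andP[a b] c; split; split=> // l ln.
  by apply: dvdz_trans (c l _); rewrite ?leq_max ?ln // PoszM dvdz_mulr.
by apply: dvdz_trans (c l _); rewrite ?leq_max ?ln ?orbT // PoszM dvdz_mull.
Qed.

(** [n] bounds the variables that occur in [f]; this is why an atom can reduce finitely many
    coordinates only. *)
Lemma affine_mod f : affine f -> exists n, forall N x y,
  (forall l, (l < n)%N -> (N %| x l - y l)%Z) -> (N %| f x - f y)%Z.
Proof.
elim=> {f} [c|c i|f g _ [n Hn] _ [m Hm]].
- by exists 0%N => N x y _; rewrite subrr dvdz0.
- by exists i.+1 => N x y /(_ _ (ltnSn i)) H; rewrite -mulrBr dvdz_mull.
- exists (maxn n m) => N x y H.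
  have -> : f x + g x - (f y + g y) = (f x - f y) + (g x - g y) by ring.
  by apply: rpredD; [apply: Hn|apply: Hm] => l ll; apply: H; rewrite leq_max ll ?orbT.
Qed.

(** * Atoms and their fibres *)

Lemma presburger_same_atom S : presburger S -> exists A N n, (0 < N)%N /\
  forall x y, same_atom A N n x y -> S x -> S y.
Proof.
elim=> {S} [f af|f N af N0|S _ [A [N [n [N0 H]]]]|S T _ [A [N [n [N0 H]]]] _ [B [M [m [M0 H']]]]].
- exists [:: exist _ f af], 1%N, 0%N; split=> // x y [] /=.
  by rewrite andbT => /eqP ->.
- have [n Hn] := affine_mod af.
  exists [::], N, n; split=> // x y [_ /Hn].
  by rewrite -opprB rpredN => h d; rewrite -(subrK (f x) (f y)) rpredD.
- by exists A, N, n; split=> // x y /same_atom_sym/H h nS /h.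
- exists (A ++ B), (N * M)%N, (maxn n m); split; first by rewrite muln_gt0 N0.
  by move=> x y /same_atom_cat[/H h /H' h'] [/h ? /h'].
Qed.

(** The forms and moduli of all tests of the tree are collected, so that the points of one atom
    follow the same branch and reach the same leaf. *)
Lemma pwpoly_same_atom e g : pwpoly e g -> exists A N n, (0 < N)%N /\
  forall y, exists2 h, polyfun e h & forall x, same_atom A N n x y -> g x = h x.
Proof.
elim=> {g} [h ph|D g1 g2 g dD _ [A [N [n [N0 H]]]] _ [B [M [m [M0 H']]]] e1 e2].
  by exists [::], 1%N, 0%N; split=> // y; exists h.
have [C [L [l [L0 HD]]]] := presburger_same_atom dD.
exists (C ++ (A ++ B)), (L * (N * M))%N, (maxn l (maxn n m)); split; first by rewrite !muln_gt0 N0 L0.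
move=> y; case: (classic (D y)) => Dy.
  have [h ph eh] := H y; exists h => // x /same_atom_cat[/same_atom_sym/HD/(_ Dy) Dx /same_atom_cat[xy _]].
  by rewrite e1 // eh.
have [h ph eh] := H' y; exists h => // x /same_atom_cat[/HD Dx /same_atom_cat[_ xy]].
by rewrite e2 ?eh // => /Dx.
Qed.

(** The vector of signs together with the vector of residues is a complete invariant with finitely
    many values. It lets atoms index finite unions and partitions of sums. *)
Lemma same_atom_key A N n : (0 < N)%N -> exists (K : finType) (key : env -> K),
  forall x y, key x = key y <-> same_atom A N n x y.
Proof.
move=> N0; pose sg x := map_tuple (fun f : affine_form => 0 <= sval f x) (in_tuple A).
(* [inord] needs an ordinal type of successor size; [N.-1.+1] equals [N] because [N] is positive. *)
pose md (x : env) := [ffun l : 'I_n => inord `|(x l %% N)%Z|%N : 'I_N.-1.+1].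
exists ((size A).-tuple bool * {ffun 'I_n -> 'I_N.-1.+1})%type, (fun x => (sg x, md x)).
have Nz : N%:Z != 0 by rewrite eqz_nat -lt0n.
have lt (a : int) : (`|(a %% N)%Z| < N.-1.+1)%N.
  by rewrite prednK // -ltz_nat gez0_abs ?modz_ge0 // ltz_pmod.
have sgP x y : sg x = sg y <-> all (fun f : affine_form => (0 <= sval f x) == (0 <= sval f y)) A.
  split=> [/(congr1 val) /=|H]; last apply: val_inj => /=.
    by elim: A {sg md} => //= f A IH [-> /IH ->]; rewrite eqxx.
  by elim: A H {sg md} => //= f A IH /andP[/eqP -> /IH ->].
move=> x y; split=> [e|[/sgP -> b]].
  have /sgP a := congr1 fst e; have /= b := congr1 snd e.
  split=> // l ln; move/ffunP/(_ (Ordinal ln)): b; rewrite !ffunE => /(congr1 val).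
  rewrite /= !inordK // => eq_mod; rewrite -eqz_mod_dvd; apply/eqP.
  by rewrite -[LHS]gez0_abs ?modz_ge0 // eq_mod gez0_abs ?modz_ge0.
congr (_, _); apply/ffunP => l; rewrite !ffunE; congr (inord `|_|).
by apply/eqP; rewrite eqz_mod_dvd b.
Qed.

(** * Families of integer intervals with piecewise linear end points *)

Definition opt_pwlinear (o : option (env -> int)) : Prop := if o is Some g then pwlinear g else True.
Definition opt_lower (o : option (env -> int)) x (s : int) : Prop := if o is Some g then g x <= s else True.
Definition opt_upper (o : option (env -> int)) x (s : int) : Prop := if o is Some g then s <= g x else True.

(** [None] stands for an infinite bound, and [D] collects the conditions that do not involve [s]. *)
Definition interval_family (R : env -> int -> Prop) := exists D L U,
  [/\ presburger D, opt_pwlinear L, opt_pwlinear U & forall x s, R x s <-> [/\ D x, opt_lower L x s & opt_upper U x s]].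

Lemma interval_family_ext R R' : (forall x s, R x s <-> R' x s) -> interval_family R -> interval_family R'.
Proof.
by move=> e [D [L [U [dD PL PU H]]]]; exists D, L, U; split=> // x s; rewrite -e H.
Qed.

Lemma interval_family_presburger D : presburger D -> interval_family (fun x _ => D x).
Proof. by move=> dD; exists D, None, None; split=> // x s; split=> [|[]]. Qed.

Lemma interval_family_and R R' : interval_family R -> interval_family R' -> interval_family (fun x s => R x s /\ R' x s).
Proof.
move=> [D [L [U [dD PL PU H]]]] [D' [L' [U' [dD' PL' PU' H']]]].
exists (fun x => D x /\ D' x).
pose L2 := if L is Some l then if L' is Some l' then Some (fun x => Num.max (l x) (l' x)) else L else L'.
pose U2 := if U is Some u then if U' is Some u' then Some (fun x => Num.min (u x) (u' x)) else U else U'.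
exists L2, U2; split; first exact: presburger_and.
- by rewrite /L2; case: L L' PL PL' {H H' L2} => [l|] [l'|] //=; exact: pwlinear_max.
- by rewrite /U2; case: U U' PU PU' {H H' U2} => [l|] [l'|] //=; exact: pwlinear_min.
move=> x s; rewrite H H'.
have hL : opt_lower L2 x s <-> opt_lower L x s /\ opt_lower L' x s.
  rewrite /L2; case: L L' {H H' PL PL' L2} => [l|] [l'|] /=; try tauto.
  by rewrite ge_max; split=> /andP.
have hU : opt_upper U2 x s <-> opt_upper U x s /\ opt_upper U' x s.
  rewrite /U2; case: U U' {H H' PU PU' U2} => [l|] [l'|] /=; try tauto.
  by rewrite le_min; split=> /andP.
by split=> [[[? ? ?] [? ? ?]]|[[? ?] /hL[? ?] /hU[? ?]]]; split=> //; [apply/hL|apply/hU].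
Qed.

Lemma interval_family_lin g (c : int) : affine g -> interval_family (fun x s => 0 <= g x + c * s).
Proof.
move=> ag; case: (ltgtP c 0) => [c0|c0|->]; last first.
- apply: interval_family_ext (interval_family_presburger (presburger_ge ag)) => x s; by rewrite mul0r addr0.
- have [m m0 ->] : exists2 m : nat, (0 < m)%N & c = m%:Z.
    by case: c c0 => // m m0; exists m.
  (* The lower bound is the ceiling of - g / m, written as a negated floor. *)
  exists (fun=> True), (Some (fun x => -1 * (g x %/ m)%Z)), None; split=> //.
  + exact: presburger_const.
  + by apply: pwlinearZ; exact: pwlinear_div m0 (pwlinear_aff ag).
  move=> x s; rewrite /= mulN1r lerNl lez_divRL ?ltz_nat //.
  have -> : (- s * m%:Z <= g x) = (0 <= g x + m%:Z * s) by lia.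
  by split=> [|[]].
- have [m m0 ->] : exists2 m : nat, (0 < m)%N & c = - m%:Z.
    by exists `|c|%N; lia.
  exists (fun=> True), None, (Some (fun x => (g x %/ m)%Z)); split=> //.
  + exact: presburger_const.
  + exact: pwlinear_div m0 (pwlinear_aff ag).
  move=> x s; rewrite /= lez_divRL ?ltz_nat //.
  have -> : (s * m%:Z <= g x) = (0 <= g x + - m%:Z * s) by lia.
  by split=> [|[]].
Qed.

Lemma pwpoly_upd i e f h : polyfun e f -> pwpoly 1 h ->
  exists2 w, pwpoly e w & forall x z, z%:~R = h x -> f (upd x i z) = w x.
Proof.
move=> pf; elim=> {h} [h /(polyfun_subst i pf)[w pw ew]|D g1 g2 g dD _ [w1 P1 E1] _ [w2 P2 E2] e1 e2].
  by exists w => //; exact: pwpoly_poly.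
exists (fun x => if excluded_middle_informative (D x) then w1 x else w2 x).
  by apply: (pwpoly_if dD P1 P2) => x; case: excluded_middle_informative.
move=> x z; case: excluded_middle_informative => Dx.
  by rewrite (e1 x) //; exact: E1.
by rewrite (e2 x) //; exact: E2.
Qed.

Section Cells.
Variables (A : seq affine_form) (N n i : nat) (y : env).
Hypotheses (N0 : (0 < N)%N) (ilt : (i < n)%N).

Lemma same_atom_upd_dvd x t : same_atom A N n (upd x i t) y -> exists s, t = y i + N%:Z * s.
Proof.
move=> [_ H]; have := H i ilt; rewrite updE => /dvdzP[q e].
by exists q; rewrite mulrC -e addrC subrK.
Qed.

(** In the form t = y i + N s the congruence on coordinate i is automatic, the other congruences do
    not involve s, and each sign condition is one linear inequality in s. *)
Lemma same_atom_cell : interval_family (fun x s => same_atom A N n (upd x i (y i + N%:Z * s)) y).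
Proof.
have dM : presburger (fun x => forall l : 'I_n, val l <> i -> (N %| x l - y l)%Z).
  apply: presburger_allT => l; apply: presburger_imp; first exact: presburger_const.
  by apply: presburger_dvd => //; apply: affineB; [exact: affine_proj|exact: affine_const].
have sg : interval_family (fun x s => all (fun f : affine_form =>
    (0 <= sval f (upd x i (y i + N%:Z * s))) == (0 <= sval f y)) A).
  elim: A => [|[f af] A' IH] /=.
    by apply: interval_family_ext (interval_family_presburger (presburger_const True)).
  have [c [g [ag eg]]] := affine_upd i af.
  have E x s : f (upd x i (y i + N%:Z * s)) = (g x + c * y i) + c * N * s.
    by rewrite eg mulrDr addrA mulrA.
  have H1 : interval_family (fun x s => (0 <= f (upd x i (y i + N%:Z * s))) = (0 <= f y)).
    have ag' := affine_add ag (affine_const (c * y i)).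
    case: (0 <= f y).
      by apply: interval_family_ext (interval_family_lin (c * N) ag') => x s; rewrite E.
    (* Over the integers f < 0 means 0 <= -1 - f, which is again of the form treated. *)
    apply: interval_family_ext (interval_family_lin (- (c * N)) (affineB (affine_const (-1)) ag')) => x s.
    by rewrite E; split=> H; lia.
  apply: interval_family_ext (interval_family_and H1 IH) => x s.
  by split=> [[-> ->]|/andP[/eqP ? ?]]; rewrite ?eqxx.
apply: interval_family_ext (interval_family_and sg (interval_family_presburger dM)) => x s.
split=> [[a b]|[a b]]; split=> // l.
  move=> ln; rewrite /upd; case: eqP => [->|ne]; last exact: (b (Ordinal ln)).
  by rewrite addrC addKr dvdz_mulr.
by have := b l (ltn_ord l); rewrite /upd; case: eqP.
Qed.

Lemma cell_ex : presburger (fun x => exists t, same_atom A N n (upd x i t) y).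
Proof.
have [D [L [U [dD PL PU H]]]] := same_atom_cell.
apply: (@presburger_ext (fun x => D x /\
    if L is Some l then if U is Some u then l x <= u x else True else True)).
  move=> x; split=> [[Dx LU]|[t st]].
    pose s := if L is Some l then l x else if U is Some u then u x else 0.
    exists (y i + N%:Z * s); apply/H; split=> //; rewrite /s.
      by case: L {PL H s LU} => //=.
    by case: L U LU {PL PU H s} => [l|] [u|] //=.
  have [s e] := same_atom_upd_dvd st; rewrite e in st; have [? h1 h2] := (H _ _).1 st.
  split=> //; case: L U h1 h2 {PL PU H} => [l|] [u|] //=; exact: le_trans.
apply: presburger_and => //; case: L U PL PU {H} => [l|] [u|] /= *; try exact: presburger_const.
exact: presburger_pwlinear_le.
Qed.

Lemma exists_notin (f : nat -> int) (ts : seq int) : injective f -> exists m, f m \notin ts.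
Proof.
move=> inj; apply: NNPP => H.
have sub : {subset map f (iota 0 (size ts).+1) <= ts}.
  move=> _ /mapP[m _ ->]; apply/negPn/negP => fm; by apply: H; exists m.
have := uniq_leq_size _ sub; rewrite map_inj_uniq // iota_uniq size_map size_iota.
by move/(_ isT); rewrite ltnn.
Qed.

(** The sum over s from L to U telescopes to G (U + 1) - G (L), where G is an antiderivative of the
    summand in s. *)
Lemma cell_sum e h : polyfun e h -> exists2 w, pwpoly e.+1 w & forall x (ts : seq int), uniq ts ->
  (forall t, t \in ts <-> same_atom A N n (upd x i t) y) ->
  w x = \sum_(t <- ts) h (upd x i t).
Proof.
move=> ph; have Nz : N%:Z != 0 by rewrite eqz_nat -lt0n.
have [D [L [U [dD PL PU H]]]] := same_atom_cell.
(* With an infinite bound the fibre over a point of [D] is infinite, so no list enumerates it and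
   the claim is vacuous there. *)
have inf x (ts : seq int) : (forall t, t \in ts <-> same_atom A N n (upd x i t) y) -> D x ->
    (if L is Some l then if U is Some u then False else True else True) -> False.
  move=> ex Dx LU.
  have cinj (a b : int) : b != 0 -> injective (fun m : nat => y i + N%:Z * (a + b * m%:Z)).
    by move=> b0 m m' /addrI /(mulfI Nz) /addrI /(mulfI b0) [].
  have out (a b : int) : b != 0 -> (forall m : nat, opt_lower L x (a + b * m%:Z) /\ opt_upper U x (a + b * m%:Z)) -> False.
    move=> b0 H'; have [m] := exists_notin ts (cinj a b b0).
    by move/negP; apply; apply/ex/H; have [] := H' m.
  case: L U LU out {PL PU H} => [l|] [u|] //= _ out.
  + apply: (out (l x) 1) => // m; split=> //; lia.
  + apply: (out (u x) (-1)) => // m; split=> //; lia.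
  + by apply: (out 0 1).
have zero x (ts : seq int) : (forall t, t \in ts <-> same_atom A N n (upd x i t) y) ->
   (forall s, ~ [/\ D x, opt_lower L x s & opt_upper U x s]) -> \sum_(t <- ts) h (upd x i t) = 0.
  move=> ex none; case: ts ex => [|t ts] ex; first by rewrite big_nil.
  have st : same_atom A N n (upd x i t) y by apply/ex; rewrite inE eqxx.
  by have [s es] := same_atom_upd_dvd st; rewrite es in st; move/H: st => /none.
have [LU|[l [u [eL eU]]]] :
    (if L is Some l then if U is Some u then False else True else True) \/
    exists l u, L = Some l /\ U = Some u.
- by case: L U {PL PU H inf zero} => [l|] [u|]; try (by left); right; exists l, u.
- exists (fun=> 0); first exact: pwpoly_const.
  move=> x ts _ ex; rewrite (zero _ _ ex) // => s [Dx _ _]; exact: (inf _ _ ex Dx LU).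
subst L U; rewrite /= in PL PU H zero {inf}.
(* Coordinate i is reused: from here on it holds the index s instead of the value t. *)
have aN : affine (fun x => y i + N%:Z * x i) by apply: affine_add (affine_const _) (affine_var _ _).
have [h' ph' eh'] := polyfun_subst i ph (polyfun_aff aN).
have [G pG eG] := polyfun_antidiff i ph'.
have Gsub (g : env -> int) : pwlinear g -> pwpoly e.+1 (fun x => G (upd x i (g x))).
  by move=> /(pwpoly_upd i pG)[w' Pw' ew']; apply: pwpoly_ext Pw' => x; rewrite -(ew' _ (g x)).
(* The guard is needed because the telescoped difference need not vanish when u + 1 < l. *)
pose w x := if excluded_middle_informative (D x /\ l x <= u x)
  then G (upd x i (u x + 1)) - G (upd x i (l x)) else 0.
exists w.
  have P1 : pwpoly e.+1 (fun x => G (upd x i (u x + 1)) - G (upd x i (l x))).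
    apply: pwpoly_ext (pwpoly_add (Gsub _ (pwlinear_add PU (pwlinear_aff (affine_const 1)))) (pwpolyZ (-1) (Gsub _ PL))) => x.
    by rewrite mulN1r.
  by apply: (pwpoly_if (presburger_and dD (presburger_pwlinear_le PL PU)) P1 (pwpoly_const _ 0)) => x; rewrite /w;
    case: excluded_middle_informative.
move=> x ts uts ex; rewrite /w; case: excluded_middle_informative => [[Dx lu]|n0]; last first.
  by rewrite (zero _ _ ex) // => s [Dx a b]; apply: n0; split=> //; exact: le_trans a b.
pose m := absz (u x - l x + 1).
have pe : perm_eq ts [seq y i + N%:Z * (l x + j%:Z) | j <- iota 0 m].
  apply: uniq_perm => //.
    by rewrite map_inj_uniq ?iota_uniq // => a b /addrI /(mulfI Nz) /addrI [].
  move=> t; apply/idP/mapP => [/ex st|[j]].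
    have [s es] := same_atom_upd_dvd st; rewrite es in st; have [_ a b] := (H _ _).1 st.
    exists (absz (s - l x)); first by rewrite mem_iota /m; lia.
    by rewrite es; congr (_ + _ * _); lia.
  rewrite mem_iota /m => jm ->; apply/ex/H; split=> //; lia.
rewrite (perm_big _ pe) /= big_map.
transitivity (\sum_(j <- iota 0 m) (G (upd x i (l x + j.+1%:Z)) - G (upd x i (l x + j%:Z)))).
  have -> : iota 0 m = index_iota 0 m by rewrite /index_iota subn0.
  rewrite telescope_sumr // addr0; congr (G (upd _ _ _) - _).
  by rewrite /m; lia.
apply: eq_bigr => j _.
have -> : l x + j.+1%:Z = l x + j%:Z + 1 by lia.
rewrite eG -(eh' _ (y i + N%:Z * (l x + j%:Z))) ?upd_upd // updE //.
Qed.
End Cells.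

(** A one-point fibre has a finite lower bound, since otherwise s - 1 would yield a second point;
    the point is then the lower end of the progression. *)
Lemma cell_select A N n i y : (0 < N)%N -> (i < n)%N ->
  exists2 h, pwpoly 1 h & forall x t,
    (forall t', same_atom A N n (upd x i t') y <-> t' = t) -> h x = t%:~R.
Proof.
move=> N0 ilt; have [D [L [U [dD PL PU H]]]] := same_atom_cell A y N0 ilt.
case: L PL H => [l|] PL H.
  exists (fun x => (y i + N%:Z * l x)%:~R).
    by apply: pwlinear_add; [exact: pwlinear_aff (affine_const _)|exact: pwlinearZ].
  move=> x t ex; congr (_%:~R); apply/ex/H.
  have [s es] := same_atom_upd_dvd ilt ((ex t).2 erefl).
  have /H[Dx /= ls us] : same_atom A N n (upd x i (y i + N%:Z * s)) y by apply/ex.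
  by split=> //; case: U us {PU H} => //= u; exact: le_trans.
exists (fun=> 0); first exact: pwpoly_const.
move=> x t ex; have [s es] := same_atom_upd_dvd ilt ((ex t).2 erefl).
have /H[Dx _ us] : same_atom A N n (upd x i (y i + N%:Z * s)) y by apply/ex.
have : same_atom A N n (upd x i (y i + N%:Z * (s - 1))) y.
  by apply/H; split=> //; case: U us {PU H} => //= u; lia.
by move/ex; rewrite es => /addrI/mulfI; rewrite eqz_nat -lt0n => /(_ N0); lia.
Qed.

(** * Eliminating one variable, then a block of variables *)

Lemma presburger_pwpoly_same_atom i e S u : presburger S -> pwpoly e u -> exists A N n,
  [/\ (0 < N)%N, (i < n)%N, forall x y, same_atom A N n x y -> S x -> S y &
   forall y, exists2 h, polyfun e h & forall x, same_atom A N n x y -> u x = h x].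
Proof.
move=> /presburger_same_atom[A [N [n [N0 HS]]]] /pwpoly_same_atom[B [M [m [M0 Hu]]]].
(* The third atom system, with no forms and modulus 1, only pushes the number of reduced coordinates
   beyond [i]. *)
exists (A ++ (B ++ [::])), (N * (M * 1))%N, (maxn n (maxn m i.+1)).
split=> [||x y /same_atom_cat[/HS]//|y]; first by rewrite !muln_gt0 N0 M0.
  by rewrite !leq_max leqnn !orbT.
by have [h ph eh] := Hu y; exists h => // x /same_atom_cat[_ /same_atom_cat[/eh]].
Qed.

(** An atom that meets [S] lies inside [S], so the projection of [S] is the finite union of the
    projections of such atoms. *)
Lemma presburger_ex i S : presburger S -> presburger (fun x => exists t, S (upd x i t)).
Proof.
move=> /(presburger_pwpoly_same_atom i) /(_ (pwpoly_const 0 0))[A [N [n [N0 ilt HS _]]]].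
have [K [key keyP]] := same_atom_key A n N0.
pose C (k : K) x := (exists2 y, key y = k & S y) /\ exists t, key (upd x i t) = k.
apply: (@presburger_ext (fun x => exists k, C k x)).
  move=> x; split=> [[k [[y yk Sy] [t tk]]]|[t St]].
    by exists t; apply: HS Sy; apply/keyP; rewrite yk.
  by exists (key (upd x i t)); split; [exists (upd x i t)|exists t].
apply: presburger_exT => k; case: (classic (exists2 y, key y = k & S y)) => [[y <- Sy]|n0].
  apply: presburger_ext (cell_ex A y N0 ilt) => x; split=> [[t /keyP ?]|[_ [t /keyP ?]]].
    by split; [exists y|exists t].
  by exists t.
by apply: presburger_ext (presburger_const False) => x; split=> // [[]].
Qed.

Lemma presburger_exs (vs : seq nat) S : presburger S ->
  presburger (fun x => exists2 y, forall l, l \notin vs -> y l = x l & S y).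
Proof.
elim: vs S => [|i vs IH] S dS.
  apply: presburger_ext dS => x; split=> [|[y e]]; first by exists x.
  by suff -> : y = x by []; apply: functional_extensionality => l; exact: e.
apply: presburger_ext (presburger_ex i (IH S dS)) => x; split=> [[t [y e Sy]]|[y e Sy]].
  exists y => // l; rewrite inE negb_or => /andP[/negPf li /e ->].
  by rewrite /upd li.
exists (y i), y => // l lvs; rewrite /upd; case: eqP => [->//|/eqP li].
by apply: e; rewrite inE negb_or li.
Qed.

Lemma pwpoly_fiber_sum i e S u : presburger S -> pwpoly e u ->
  exists2 w, pwpoly e.+1 w & forall x (ts : seq int), uniq ts ->
    (forall t, t \in ts <-> S (upd x i t)) -> w x = \sum_(t <- ts) u (upd x i t).
Proof.
move=> /(presburger_pwpoly_same_atom i) H /H {H} [A [N [n [N0 ilt HS Hu]]]].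
have [K [key keyP]] := same_atom_key A n N0.
have /fin_all_exists2[w Pw Hw] (k : K) : exists2 w, pwpoly e.+1 w &
    forall x (ts : seq int), uniq ts -> (forall t, t \in ts <-> S (upd x i t)) ->
      w x = \sum_(t <- ts | key (upd x i t) == k) u (upd x i t).
  case: (classic (exists2 y, key y = k & S y)) => [[y <- Sy]|n0].
    have [h ph eh] := Hu y.
    have [w Pw Hw] := cell_sum A y N0 ilt ph.
    exists w => // x ts uts ex.
    rewrite (Hw x [seq t <- ts | key (upd x i t) == key y]) ?filter_uniq //.
      rewrite big_filter; apply: eq_bigr => t /eqP/keyP s; by rewrite eh.
    move=> t; rewrite mem_filter; split=> [/andP[/eqP/keyP]//|s].
    by apply/andP; split; [exact/eqP/keyP|apply/ex; exact: HS (same_atom_sym s) Sy].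
  exists (fun=> 0); first exact: pwpoly_const.
  move=> x ts _ ex; rewrite big1_seq // => t /andP[/eqP kt /ex St].
  by case: n0; exists (upd x i t).
exists (fun x => \sum_k w k x); first exact: pwpoly_sum.
move=> x ts uts ex.
rewrite (partition_big (fun t => key (upd x i t)) xpredT) //=.
by apply: eq_bigr => k _; exact: Hw.
Qed.

(** Recovers a function from its Presburger graph. Every atom inside [S] that meets the line over x
    finds the same unique point, so it does not matter which one [pwpoly_choose] takes. *)
Lemma pwpoly_select i S : presburger S -> exists2 g, pwpoly 1 g & forall x t,
  (forall t', S (upd x i t') <-> t' = t) -> g x = t%:~R.
Proof.
move=> /(presburger_pwpoly_same_atom i) /(_ (pwpoly_const 0 0))[A [N [n [N0 ilt HS _]]]].
have [K [key keyP]] := same_atom_key A n N0.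
have /fin_all_exists[p Hp] (k : K) : exists p : (env -> Prop) * (env -> rat),
    [/\ presburger p.1, pwpoly 1 p.2,
      forall x t, S (upd x i t) -> key (upd x i t) = k -> p.1 x &
      forall x t, (forall t', S (upd x i t') <-> t' = t) -> p.1 x -> p.2 x = t%:~R].
  case: (classic (exists2 y, key y = k & S y)) => [[y <- Sy]|n0].
    have [h Ph Hh] := cell_select A y N0 ilt.
    exists (fun x => exists t, same_atom A N n (upd x i t) y, h); split=> //=.
    + exact: cell_ex.
    + by move=> x t _ /keyP; exists t.
    move=> x t Ht [t1 s1]; apply: Hh => t'; split=> [s'|->].
      by apply/Ht; apply: HS Sy; exact: same_atom_sym.
    by have /Ht <- : S (upd x i t1) by apply: HS Sy; exact: same_atom_sym.
  exists (fun=> False, fun=> 0); split=> //=; [exact: presburger_const|exact: pwpoly_const|].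
  by move=> x t St kt; case: n0; exists (upd x i t).
have [|| g Pg Hg] := @pwpoly_choose 1 K (fun k => (p k).1) (fun k => (p k).2).
- by move=> k; have [] := Hp k.
- by move=> k; have [] := Hp k.
exists g => // x t Ht; have [|k pk ->] := Hg x.
  exists (key (upd x i t)); have [_ _ H _] := Hp (key (upd x i t)).
  by apply: H erefl; apply/Ht.
by have [_ _ _ H] := Hp k; exact: H.
Qed.

Definition splice (x : env) (k : nat) (s : seq int) : env :=
  fun l => if (k <= l < k + size s)%N then s`_(l - k) else x l.

Lemma splice_nil x k : splice x k [::] = x.
Proof.
apply: functional_extensionality => l; rewrite /splice addn0.
by case: ifP => // /andP[a b]; have := leq_ltn_trans a b; rewrite ltnn.
Qed.

Lemma splice_cons x k t s : splice x k (t :: s) = splice (upd x k t) k.+1 s.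
Proof.
apply: functional_extensionality => l; rewrite /splice /upd /= addnS addSn.
case: (ltngtP k l) => [kl|kl|->] //=; last by rewrite subnn leq_addr.
by have -> : (l - k = (l - k.+1).+1)%N by lia.
Qed.

Lemma presburger_splice k d S : presburger S -> presburger (fun x => exists2 s, size s = d & S (splice x k s)).
Proof.
move=> dS; apply: presburger_ext (presburger_exs (iota k d) dS) => x; split=> [[y e Sy]|[s sd Ss]].
  exists (mkseq (fun j => y (k + j)%N) d); first by rewrite size_mkseq.
  suff -> : splice x k (mkseq (fun j => y (k + j)%N) d) = y by [].
  apply: functional_extensionality => l; rewrite /splice size_mkseq.
  case: ifP => [/andP[a b]|/negbT n0]; last by rewrite e // mem_iota.
  by rewrite nth_mkseq ?subnKC // ltn_subLR.
exists (splice x k s) => // l; rewrite mem_iota /splice sd.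
by move/negPf ->.
Qed.

(** Iterated summation: the tails are summed first for a fixed head, then the heads, which range
    over the fibre of a projection of [S]. Each round costs one degree. *)
Lemma pwpoly_splice_sum d k e S u : presburger S -> pwpoly e u ->
  exists2 w, pwpoly (e + d) w & forall x (L : seq (seq int)), uniq L ->
    (forall s, s \in L <-> size s = d /\ S (splice x k s)) ->
    w x = \sum_(s <- L) u (splice x k s).
Proof.
move=> dS Pu; elim: d k => [|d IH] k.
  (* With no coordinate left, [L] is the singleton of the empty list or empty, according to
     [S x]. *)
  exists (fun x => if excluded_middle_informative (S x) then u x else 0).
    rewrite addn0; apply: (pwpoly_if dS Pu (pwpoly_const e 0)) => x; by case: excluded_middle_informative.
  move=> x L uL ex; case: excluded_middle_informative => Sx.
    rewrite (perm_big [:: [::]]) ?big_seq1 ?splice_nil //.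
    apply: uniq_perm => // s; rewrite inE; apply/idP/eqP => [/ex[/size0nil]//|->].
    by apply/ex; rewrite splice_nil.
  rewrite big1_seq // => s /andP[_ /ex[/size0nil ->]]; by rewrite splice_nil.
have [w' Pw' Hw'] := IH k.+1.
have [w Pw Hw] := pwpoly_fiber_sum k (presburger_splice k.+1 d dS) Pw'.
exists w; first by rewrite addnS.
move=> x L uL ex; pose ts := undup (map (head 0) L).
rewrite (Hw x ts) ?undup_uniq //; last first.
  move=> t; rewrite mem_undup; split=> [/mapP[s /ex[]]|[s sd Ss]].
    by case: s => //= a s [sd] Ss ->; exists s => //; rewrite -splice_cons.
  by apply/mapP; exists (t :: s) => //; apply/ex; split; rewrite ?splice_cons //= sd.
pose Lt t := [seq behead s | s <- L & head 0 s == t].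
have cs s : s \in L -> s = head 0 s :: behead s by move=> /ex[]; case: s.
transitivity (\sum_(t <- ts) \sum_(s <- L | head 0 s == t) u (splice x k s)).
  apply: eq_bigr => t _; rewrite (Hw' _ (Lt t)).
  - rewrite big_map big_filter big_seq_cond [RHS]big_seq_cond.
    by apply: eq_bigr => s /andP[/cs es /eqP ht]; rewrite -splice_cons -ht -es.
  - rewrite map_inj_in_uniq ?filter_uniq // => s s'.
    rewrite !mem_filter => /andP[/eqP h1 /cs e1] /andP[/eqP h2 /cs e2] eb.
    by rewrite e1 e2 h1 h2 eb.
  - move=> s; split=> [/mapP[s']|[sd Ss]].
      by rewrite mem_filter => /andP[/eqP <- sL] ->; move/ex: (sL) => [sz];
       rewrite {1}(cs _ sL) splice_cons; split=> //; rewrite size_behead sz.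
    apply/mapP; exists (t :: s) => //; rewrite mem_filter eqxx /=; apply/ex.
    by rewrite splice_cons /= sd.
rewrite (exchange_big_dep xpredT) //= big_seq [RHS]big_seq.
apply: eq_bigr => s sL; rewrite -big_filter (perm_big [:: head 0 s]) ?big_seq1 //.
apply: uniq_perm => //; first by rewrite filter_uniq ?undup_uniq.
move=> t; rewrite mem_filter inE eq_sym; apply/andP/idP => [[]//|/eqP ->].
by rewrite eqxx mem_undup map_f.
Qed.

(** * Presburger sets are semisimple *)

(** The notions of the theorem over an arbitrary abelian group, because the induction on the
    dimension works in products ['rV[int]_k * int]. *)
Definition gindep (V : zmodType) r (g : 'I_r -> V) := forall c : 'I_r -> int,
  \sum_i g i *~ c i = 0 -> forall i, c i = 0.

Definition gsimple (V : zmodType) (S : V -> Prop) := exists (p : V) r (g : 'I_r -> V),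
  gindep g /\ forall x, S x <-> exists c : 'I_r -> nat, x = p + \sum_i g i *+ c i.

(** With any finite index type allowed, a union of semisimple sets is indexed by a dependent sum
    without renumbering. *)
Definition gsemisimple (V : zmodType) (S : V -> Prop) := exists (I : finType) (P : I -> V -> Prop),
  [/\ forall i, gsimple (P i), forall i j x, P i x -> P j x -> i = j &
      forall x, S x <-> exists i, P i x].

Lemma gsemisimple_ext (V : zmodType) (S T : V -> Prop) : (forall x, S x <-> T x) -> gsemisimple S -> gsemisimple T.
Proof. by move=> e [I [P [a b c]]]; exists I, P; split=> // x; rewrite -e. Qed.

Lemma gsimple_gsemisimple (V : zmodType) (S : V -> Prop) : gsimple S -> gsemisimple S.
Proof.
move=> H; exists unit, (fun=> S); split=> // [[] []//|x].
by split=> [|[]//]; exists tt.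
Qed.

Lemma gsemisimple_empty (V : zmodType) (S : V -> Prop) : (forall x, ~ S x) -> gsemisimple S.
Proof.
move=> H; exists void, (fun _ _ => False); split=> //.
by move=> x; split=> [/H|[]].
Qed.

Lemma gsemisimple_union (V : zmodType) (I : finType) (S : I -> V -> Prop) (T : V -> Prop) :
  (forall i, gsemisimple (S i)) -> (forall i j x, S i x -> S j x -> i = j) ->
  (forall x, T x <-> exists i, S i x) -> gsemisimple T.
Proof.
move=> sS disj cov; have /fin_all_exists[J] := sS.
move=> /fin_all_exists[P HP].
exists {i : I & J i}, (fun ij x => P (tag ij) (tagged ij) x); split.
- by move=> [i j] /=; have [] := HP i.
- move=> [i j] [i' j'] x /= Px Px'.
  have e : i = i'.
    apply: disj (x) _ _.
      by have [_ _ H] := HP i; apply/H; exists j.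
    by have [_ _ H] := HP i'; apply/H; exists j'.
  by subst i'; have [_ H _] := HP i; rewrite (H _ _ _ Px Px').
- move=> x; rewrite cov; split=> [[i Si]|[[i j] Pij]].
    by have [_ _ H] := HP i; have [j Pj] := (H x).1 Si; exists (existT _ i j).
  by exists i; have [_ _ H] := HP i; apply/H; exists j.
Qed.

Lemma gsemisimple_or (V : zmodType) (S T : V -> Prop) : gsemisimple S -> gsemisimple T ->
  (forall x, S x -> ~ T x) -> gsemisimple (fun x => S x \/ T x).
Proof.
move=> sS sT disj; apply: (@gsemisimple_union _ bool (fun b => if b then S else T)).
- by case.
- by move=> [] [] x //= h1 h2; case: (disj x).
- by move=> x; split=> [[]|[[]]]; [exists true|exists false|left|right].
Qed.

Lemma gsemisimple_image (U V : zmodType) (f : {additive U -> V}) (p : V) (S : U -> Prop) :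
  injective f -> gsemisimple S -> gsemisimple (fun y => exists2 x, S x & y = p + f x).
Proof.
move=> finj [I [P [sP disj cov]]].
exists I, (fun i y => exists2 x, P i x & y = p + f x); split.
- move=> i; have [q [r [g [ig H]]]] := sP i; exists (p + f q), r, (f \o g); split.
    move=> c e; apply: ig; apply: finj; rewrite raddf0 -e raddf_sum.
    by apply: eq_bigr => j _; rewrite raddfMz.
  move=> y; split=> [[x /H[c ->] ->]|[c ->]].
    exists c; rewrite raddfD raddf_sum addrA; congr (_ + _).
    by apply: eq_bigr => j _; rewrite raddfMn.
  exists (q + \sum_j g j *+ c j); first by apply/H; exists c.
  rewrite raddfD raddf_sum addrA; congr (_ + _).
  by apply: eq_bigr => j _; rewrite raddfMn.
- move=> i j _ [x Px ->] [x' Px' /addrI/finj e].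
  by subst x'; exact: disj Px Px'.
- move=> y; split=> [[x /cov[i Pi] ->]|[i [x Px ->]]]; first by exists i, x.
  by exists x => //; apply/cov; exists i.
Qed.

Lemma gsemisimple_semisimple k (S : 'rV[int]_k -> Prop) : gsemisimple S -> semisimple S.
Proof.
case=> I [P [sP disj cov]]; exists #|I|, (fun i => P (enum_val i)); split=> [i|].
  have [p [r [g [ig H]]]] := sP (enum_val i); exists p, r, g; split=> // c e; apply: ig.
  by under eq_bigr => j _ do rewrite -scaler_int intz.
split=> [i j x Pi Pj|x]; first by apply: enum_val_inj; exact: disj Pi Pj.
rewrite cov; split=> [[i Pi]|[i Pi]]; last by exists (enum_val i).
by exists (enum_rank i); rewrite enum_rankK.
Qed.

Lemma sum_delta_row r (c : 'I_r -> int) :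
  \sum_j (delta_mx 0 j : 'rV[int]_r) *~ c j = \row_j c j.
Proof.
apply/rowP => l; rewrite summxE mxE (bigD1 l) //= big1 ?addr0 => [|j jl].
  by rewrite -scaler_int intz !mxE !eqxx mulr1.
by rewrite -scaler_int intz !mxE eqxx eq_sym (negPf jl) mulr0.
Qed.

Definition nonneg_row r (c : 'rV[int]_r) := forall j, 0 <= c 0 j.

Lemma nonneg_row_nat r (x : 'rV[int]_r) : nonneg_row x <->
  exists c : 'I_r -> nat, x = \row_j (c j)%:Z.
Proof.
split=> [H|[c ->] j]; last by rewrite mxE.
exists (fun j => absz (x 0 j)); apply/rowP => j; rewrite mxE gez0_abs //; exact: H.
Qed.

Lemma le_nat_ord (u : int) (h : nat) :
  (0 <= u /\ u <= h%:Z) <-> exists a : 'I_h.+1, u = a%:Z.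
Proof.
split=> [[u0 uh]|[a ->]]; last by have := ltn_ord a; lia.
have lt : (absz u < h.+1)%N by lia.
by exists (Ordinal lt) => /=; lia.
Qed.

(** Division with remainder of u - H - 1 by h: the remainder is b and the quotient is w. *)
Lemma step_divn (H u x : int) (h : nat) : 0 <= x ->
  (H < u /\ u <= H + h%:Z * x) <->
  exists (b : 'I_h) (w : nat), w%:Z < x /\ u = H + 1 + b%:Z + h%:Z * w%:Z.
Proof.
move=> x0; split=> [[lt le]|[b [w [wx ->]]]]; last first.
  have := ltn_ord b; have : h%:Z * (w%:Z + 1) <= h%:Z * x by apply: ler_wpM2l => //; lia.
  by split; [have : 0 <= h%:Z * w%:Z by apply: mulr_ge0|]; lia.
have hp : (0 < h)%N.
  by rewrite lt0n; apply/eqP => h0; move: le; rewrite h0 mul0r addr0 leNgt lt.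
pose d := absz (u - H - 1)%R; have ed : u = H + 1 + d%:Z by rewrite /d; lia.
have lt_mod := ltn_pmod d hp; have e := divn_eq d h.
exists (Ordinal lt_mod), (d %/ h)%N; split; last by rewrite /= {1}ed {1}e; lia.
rewrite -(ltr_pM2l (x := h%:Z)) // -PoszM; lia.
Qed.

Lemma step_divn_inj (H : int) (h : nat) (b b' : 'I_h) (w w' : nat) :
  H + 1 + b%:Z + h%:Z * w%:Z = H + 1 + b'%:Z + h%:Z * w'%:Z -> b = b'.
Proof.
move=> e; apply: val_inj => /=.
have : (w * h + b = w' * h + b')%N by move: e; rewrite -!PoszM; lia.
by move/(congr1 (modn^~ h)); rewrite !modnMDl !modn_small.
Qed.

(** * Integer points of an orthant below an affine function *)

Section Orthant.
Variable r : nat.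
Implicit Type z : ('rV[int]_r * int)%type.

Let dj (j : 'I_r) : 'rV[int]_r * int := (delta_mx 0 j, 0).

Lemma sum_e (c : 'I_r -> int) : \sum_j dj j *~ c j = (\row_j c j, 0).
Proof.
rewrite [LHS]surjective_pairing (raddf_sum fst) (raddf_sum snd) /=; congr (_, _).
  rewrite -sum_delta_row; apply: eq_bigr => j _; exact: (raddfMz fst).
by rewrite big1 // => j _; rewrite (raddfMz snd) mul0rz.
Qed.

Lemma gsemisimple_slice (a : int) : gsemisimple (fun z => nonneg_row z.1 /\ z.2 = a).
Proof.
apply: gsimple_gsemisimple; exists (0, a), r, dj; split.
  by move=> c; rewrite sum_e => -[/rowP H] i; have := H i; rewrite !mxE.
move=> [x u] /=; have E (c : 'I_r -> nat) : \sum_i dj i *+ c i = (\row_j (c j)%:Z, 0).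
  by rewrite -sum_e.
split=> [[/nonneg_row_nat[c ->] ->]|[c]].
  by exists c; rewrite E; congr (_, _); rewrite /= ?add0r ?addr0.
rewrite E => -[-> ->]; rewrite add0r addr0; split=> //.
by apply/nonneg_row_nat; exists c.
Qed.

Lemma gsemisimple_orthant : gsemisimple (fun z => nonneg_row z.1 /\ 0 <= z.2).
Proof.
pose g (i : 'I_r.+1) : 'rV[int]_r * int := if unlift ord0 i is Some j then dj j else (0, 1).
have E (c : 'I_r.+1 -> int) : \sum_i g i *~ c i = (\row_j c (lift ord0 j), c ord0).
  rewrite big_ord_recl /g unlift_none.
  under eq_bigr => j _ do rewrite liftK.
  rewrite sum_e [_ *~ _]surjective_pairing (raddfMz fst) (raddfMz snd) /= mul0rz intz.
  by congr (_, _); rewrite /= ?add0r ?addr0.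
apply: gsimple_gsemisimple; exists 0, r.+1, g; split.
  move=> c; rewrite E => -[/rowP H c0] i; case: (unliftP ord0 i) => [j|] -> //.
  by have := H j; rewrite !mxE.
have E' (c : 'I_r.+1 -> nat) : \sum_i g i *+ c i = (\row_j (c (lift ord0 j))%:Z, (c ord0)%:Z).
  exact: (E (fun j => (c j)%:Z)).
move=> [x u] /=; split=> [[/nonneg_row_nat[c ->] u0]|[c]].
  exists (fun i => if unlift ord0 i is Some j then c j else absz u).
  rewrite E' add0r unlift_none gez0_abs //; congr (_, _).
  by apply/rowP => j; rewrite !mxE liftK.
rewrite E' add0r => -[-> ->]; split=> //.
by apply/nonneg_row_nat; exists (fun j => c (lift ord0 j)).
Qed.

(* Allowing the terms [h j * c j] one at a time, the points gained when [h m * c m] is added to the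
   bound satisfy [u = H m c + 1 + b + h m * w] with [b < h m] and [w < c m]; for fixed [b] they form
   the image of an orthant. *)
Lemma gsemisimple_below (h0 : nat) (h : 'I_r -> nat) :
  gsemisimple (fun z => [/\ nonneg_row z.1, 0 <= z.2 & z.2 <= h0%:Z + \sum_j (h j)%:Z * z.1 0 j]).
Proof.
pose H m (x : 'rV[int]_r) : int := h0%:Z + \sum_(j < r | (j < m)%N) (h j)%:Z * x 0 j.
suff S m : (m <= r)%N -> gsemisimple (fun z => [/\ nonneg_row z.1, 0 <= z.2 & z.2 <= H m z.1]).
  have -> : (fun z => [/\ nonneg_row z.1, 0 <= z.2 & z.2 <= h0%:Z + \sum_j (h j)%:Z * z.1 0 j])
     = (fun z => [/\ nonneg_row z.1, 0 <= z.2 & z.2 <= H r z.1]); last exact: S.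
  apply: functional_extensionality => z; rewrite /H.
  by congr [/\ _, _ & _ <= _ + _]; apply: eq_bigl => j; rewrite ltn_ord.
elim: m => [_|m IH mr].
  (* For m = 0 the bound is the constant h0, and the set is a stack of h0 + 1 horizontal slices. *)
  apply: (@gsemisimple_union _ 'I_h0.+1 (fun a z => nonneg_row z.1 /\ z.2 = a%:Z)).
  - by move=> a; exact: gsemisimple_slice.
  - by move=> a b z [_ ->] [_ []] /val_inj.
  move=> z; rewrite /H big_pred0 // addr0; split=> [[z1 z2 z3]|[a [z1 z2]]].
    by have [a e] := (le_nat_ord z.2 h0).1 (conj z2 z3); exists a.
  by have [] := (le_nat_ord z.2 h0).2 (ex_intro _ a z2).
pose om := Ordinal mr.
have Hm x : H m.+1 x = H m x + (h om)%:Z * x 0 om.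
  rewrite /H (bigD1 om) //= [X in _ + X = _]addrC addrA; congr (_ + _ + _).
  apply: eq_bigl => j; rewrite ltnS ltn_neqAle andbC; congr (_ && _).
have Hge0 x : nonneg_row x -> 0 <= H m x.
  by move=> x0; apply: addr_ge0 => //; apply: sumr_ge0 => j _; apply: mulr_ge0.
pose piece (b : 'I_(h om)) z := nonneg_row z.1 /\
  exists w : nat, w%:Z < z.1 0 om /\ z.2 = H m z.1 + 1 + b%:Z + (h om)%:Z * w%:Z.
apply: (@gsemisimple_ext _ (fun z => [/\ nonneg_row z.1, 0 <= z.2 & z.2 <= H m z.1] \/
    exists b, piece b z)).
  move=> z; rewrite Hm; split=> [[[a b c]|[b [a [w W]]]]|[a b c]].
  - by split=> //; apply: ler_wpDr => //; apply: mulr_ge0.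
  - have [//|lt le] := (step_divn (H m z.1) z.2 (h om) (a om)).2; first by exists b, w.
    by split=> //; exact: le_trans (Hge0 _ a) (ltW lt).
  - case: (lerP z.2 (H m z.1)) => [?|gt]; [by left|right].
    by have [w [W W']] := (step_divn _ _ _ (a om)).1 (conj gt c); exists w; split=> //; exists W.
apply: gsemisimple_or; [exact: IH (ltnW mr)| |]; last first.
  move=> z [_ _ z2] [b [z1 [w W]]].
  have [|lt _] := (step_divn (H m z.1) z.2 (h om) (z1 om)).2; first by exists b, w.
  by move: lt; rewrite ltNge z2.
apply: (gsemisimple_union (S := piece)) => //; last first.
  by move=> a b z [_ [w [_ e1]]] [_ [w' [_]]]; rewrite e1 => /step_divn_inj.
move=> b.
(* Parameters (x, u) of a point (y, t) of the piece: coordinate m of x is w, and u = y_m - w - 1, so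
   that w < y_m becomes 0 <= u. The remaining coordinates agree, and [H m] does not see coordinate
   m. Removing h0 makes the map additive; the offset restores it. *)
pose f z : 'rV[int]_r * int := (z.1 + z.2 *: delta_mx 0 om, H m.+1 z.1 - h0%:Z).
have fE x u : f (x, u) = (x + u *: delta_mx 0 om, \sum_(j < r | (j < m.+1)%N) (h j)%:Z * x 0 j).
  by rewrite /f /H [_ - _]addrC addKr.
have fadd : zmod_morphism f.
  move=> [x u] [y v]; rewrite !fE; congr (_, _) => /=.
    by rewrite scalerBl opprD addrACA.
  by rewrite -sumrB; apply: eq_bigr => j _; rewrite !mxE mulrBr.
pose F := HB.pack_for {additive _ -> _} f (GRing.isZmodMorphism.Build _ _ f fadd).
have hp : (0 < h om)%N by case: (h om) b => [[]|].
have Fx x u j : (F (x, u)).1 0 j = x 0 j + u * (j == om)%:R.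
  by rewrite /F /= !mxE eqxx.
have Finj : injective F.
  apply: raddf_inj => -[x u] e.
  have xu : x = - u *: delta_mx 0 om.
    by apply/eqP; rewrite scaleNr -addr_eq0; apply/eqP; exact: (congr1 fst e).
  have := congr1 snd e; rewrite /F /= /H xu addrC addKr (bigD1 om) //= big1.
    rewrite !mxE !eqxx mulr1 addr0 => /eqP; rewrite mulf_eq0 oppr_eq0 eqz_nat.
    rewrite gtn_eqF //= => /eqP ->; congr (_, _).
    by rewrite oppr0 scale0r.
  by move=> j /andP[_ /negPf ne]; rewrite !mxE ne andbF !mulr0.
apply: gsemisimple_ext (gsemisimple_image (delta_mx 0 om, h0%:Z + 1 + b%:Z) Finj gsemisimple_orthant).
have Hd x a : H m (x + a *: delta_mx 0 om) = H m x.
  congr (_ + _); apply: eq_bigr => j jm; rewrite !mxE eqxx.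
  by case: eqP jm => [->|_ _]; rewrite ?ltnn //= mulr0 addr0.
have pF x u : (delta_mx 0 om, h0%:Z + 1 + b%:Z) + F (x, u) =
    (x + (u + 1) *: delta_mx 0 om, H m x + 1 + b%:Z + (h om)%:Z * x 0 om).
  rewrite /F /= /f Hm; congr (_, _) => /=.
    by rewrite scalerDl scale1r addrC addrA.
  by move: (H m x) => t; lia.
move=> [y t]; split=> [[[x u] [/= x0 u0]]|[/= y0 [w [wy et]]]].
  rewrite pF => -[-> ->]; split=> /= [j|].
    by rewrite !mxE addr_ge0 ?mulr_ge0 ?ler0n // addr_ge0.
  exists (absz (x 0 om)); rewrite Hd gez0_abs // !mxE !eqxx mulr1.
  by split=> //; rewrite ltrDl ltzD1.
exists (y - (y 0 om - w%:Z) *: delta_mx 0 om, y 0 om - w%:Z - 1).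
  split=> /= [j|]; last by lia.
  rewrite !mxE eqxx; case: eqP => [->|_]; last by rewrite mulr0 subr0.
  by rewrite mulr1 subKr.
rewrite pF; congr (_, _); first by rewrite [_ - 1 + 1]addrNK subrK.
by rewrite -scaleNr Hd !mxE !eqxx mulr1 subKr et.
Qed.
End Orthant.

(** * The induction on the dimension *)

Definition toenv k (x : 'rV[int]_k) : env := fun l => oapp (x 0) 0 (insub l).

Lemma toenv_ord k (x : 'rV[int]_k) (i : 'I_k) : toenv x i = x 0 i.
Proof. by rewrite /toenv valK. Qed.

Lemma toenv_ge k (x : 'rV[int]_k) l : (k <= l)%N -> toenv x l = 0.
Proof. by move=> kl; rewrite /toenv insubN // -leqNgt. Qed.

Lemma affine_toenv k g : affine g ->
  exists b (a : 'I_k -> int), forall x, g (toenv x) = b + \sum_i a i * x 0 i.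
Proof.
elim=> {g} [c|c l|f g _ [b [a H]] _ [b' [a' H']]].
- by exists c, (fun=> 0) => x; rewrite big1 ?addr0 // => i _; rewrite mul0r.
- case: (ltnP l k) => [lk|kl]; last first.
    by exists 0, (fun=> 0) => x; rewrite toenv_ge // mulr0 big1 ?addr0 // => i _; rewrite mul0r.
  exists 0, (fun i => c * (i == Ordinal lk)%:R) => x.
  rewrite (bigD1 (Ordinal lk)) //= eqxx mulr1 -toenv_ord /= big1 ?addr0 ?add0r // => i /negPf ->.
  by rewrite mulr0 mul0r.
- exists (b + b'), (fun i => a i + a' i) => x; rewrite H H' addrACA -big_split /=.
  by congr (_ + _); apply: eq_bigr => i _; rewrite mulrDl.
Qed.

Lemma polyfun1_toenv k h : polyfun 1 h ->
  exists b (a : 'I_k -> rat), forall x, h (toenv x) = b + \sum_i a i * (x 0 i)%:~R.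
Proof.
case/polyfun1_clear=> // _ [M M0 [g /(affine_toenv k)[b [a Hg]] e]].
have Mz : M%:R != 0 :> rat by rewrite pnatr_eq0 -lt0n.
exists (M%:R^-1 * b%:~R), (fun i => M%:R^-1 * (a i)%:~R) => x.
apply: (mulfI Mz); rewrite e Hg rmorphD /= mulrDr mulrA mulfV // mul1r; congr (_ + _).
rewrite rmorph_sum mulr_sumr; apply: eq_bigr => i _.
by rewrite !mulrA mulfV // mul1r rmorphM.
Qed.

(** Rational coefficients become integral in the parameters of a simple set: the constant is the
    value at p, and the i-th coefficient is the difference of the values at p + g_i and p. *)
Lemma polyfun1_param k r (p : 'rV[int]_k) (g : 'I_r -> 'rV[int]_k) h : polyfun 1 h ->
  (forall c : 'I_r -> nat, exists z : int, h (toenv (p + \sum_i g i *+ c i)) = z%:~R) ->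
  exists h0 (hv : 'I_r -> int), forall c : 'I_r -> int,
    h (toenv (p + \sum_i g i *~ c i)) = (h0 + \sum_i hv i * c i)%:~R.
Proof.
move=> /(polyfun1_toenv k)[b [a H]] Hz.
pose A (x : 'rV[int]_k) : rat := \sum_i a i * (x 0 i)%:~R.
have Aadd : zmod_morphism A.
  by move=> x y; rewrite /A -sumrB; apply: eq_bigr => i _; rewrite !mxE rmorphB mulrBr.
pose F := HB.pack_for {additive _ -> _} A (GRing.isZmodMorphism.Build _ _ A Aadd).
have AD x y : A (x + y) = A x + A y := raddfD F x y.
have HF x : h (toenv x) = b + A x by rewrite H.
have [h0 e0] := Hz (fun=> 0%N); rewrite big1 ?addr0 // in e0.
have /fin_all_exists[hv Hv] (i : 'I_r) : exists v : int, A (g i) = v%:~R.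
  have [z ez] := Hz (fun j => (j == i) : nat).
  exists (z - h0); rewrite rmorphB /= -ez -e0 !HF (bigD1 i) //= eqxx big1 ?addr0.
    by rewrite AD mulr1n; ring.
  by move=> j /negPf ->.
exists h0, hv => c; rewrite HF AD addrA -HF e0 rmorphD /=; congr (_ + _).
have -> : A (\sum_i g i *~ c i) = \sum_i A (g i *~ c i) := raddf_sum F _ _ _.
rewrite rmorph_sum; apply: eq_bigr => i _.
have -> : A (g i *~ c i) = A (g i) *~ c i := raddfMz F _ _.
by rewrite Hv rmorphM /= mulrzr.
Qed.

Lemma affine_nat_ge0 r (h0 : int) (h : 'I_r -> int) :
  (forall c : 'I_r -> nat, 0 <= h0 + \sum_i h i * (c i)%:Z) ->
  0 <= h0 /\ forall i, 0 <= h i.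
Proof.
move=> H; have h00 : 0 <= h0.
  by have := H (fun=> 0%N); rewrite big1 ?addr0 // => i _; rewrite mulr0.
(* A coefficient h_i <= -1 would give at most h0 - (h0 + 1) < 0 at this point. *)
split=> // i; have := H (fun j => if j == i then (absz h0).+1 else 0%N).
rewrite (bigD1 i) //= eqxx big1 ?addr0 => [|j /negPf ->]; last by rewrite mulr0.
by move=> ?; nia.
Qed.

(** With [B] parametrized by c and v measuring the distance from l, the set is the image of its
    parameter set under an injective affine map; injectivity uses the independence of the generators
    and N <> 0. *)
Lemma gsemisimple_fibered k (B : 'rV[int]_k -> Prop) (l : env -> rat) (N t0 : int)
    (Q : 'rV[int]_k -> int -> Prop) :
  N != 0 -> polyfun 1 l -> gsimple B -> (forall x, B x -> exists z : int, l (toenv x) = z%:~R) ->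
  (forall r p (g : 'I_r -> 'rV[int]_k), (forall c : 'I_r -> nat, B (p + \sum_i g i *+ c i)) ->
     gsemisimple (fun z : 'rV[int]_r * int => nonneg_row z.1 /\ Q (p + \sum_i g i *~ z.1 0 i) z.2)) ->
  gsemisimple (fun z : 'rV[int]_k * int => B z.1 /\ exists v s : int,
     [/\ z.2 = t0 + N * s, s%:~R = l (toenv z.1) + v%:~R & Q z.1 v]).
Proof.
move=> N0 pl [p [r [g [ig HB]]]] lz HQ.
have Bc (c : 'I_r -> nat) : B (p + \sum_i g i *+ c i) by apply/HB; exists c.
have [l0 [lv Hl]] := polyfun1_param pl (fun c => lz _ (Bc c)).
pose f (z : 'rV[int]_r * int) := (\sum_i g i *~ z.1 0 i, N * (\sum_i lv i * z.1 0 i + z.2)).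
have fadd : zmod_morphism f.
  move=> [x u] [y v]; congr (_, _); rewrite /=.
    by rewrite -sumrB; apply: eq_bigr => i _; rewrite !mxE mulrzBr.
  have -> : \sum_i lv i * (x - y) 0 i = \sum_i lv i * x 0 i - \sum_i lv i * y 0 i.
    by rewrite -sumrB; apply: eq_bigr => i _; rewrite !mxE mulrBr.
  by rewrite -mulrBr; congr (_ * _); rewrite opprD addrACA.
pose F := HB.pack_for {additive _ -> _} f (GRing.isZmodMorphism.Build _ _ f fadd).
have Finj : injective F.
  apply: raddf_inj => -[x u] e.
  have x0 : x = 0 by apply/rowP => j; rewrite mxE; exact: ig (congr1 fst e) j.
  have := congr1 snd e; rewrite /F /= /f /= x0 big1 ?add0r => [/eqP|i _]; last by rewrite mxE mulr0.
  by rewrite mulf_eq0 (negPf N0) => /eqP ->.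
apply: gsemisimple_ext (gsemisimple_image (p, t0 + N * l0) Finj (HQ r p g Bc)) => -[y t].
split=> [[[x u] [/= x0 q]]|[/= /HB[c ey] [v [s [et es q]]]]].
  rewrite /F /= /f => -[-> ->]; have [c ec] := (nonneg_row_nat x).1 x0; split.
    suff -> : \sum_i g i *~ x 0 i = \sum_i g i *+ c i by exact: Bc.
    by apply: eq_bigr => i _; rewrite ec mxE.
  exists u, (l0 + (\sum_i lv i * x 0 i + u)); split=> //.
    by rewrite [N * (l0 + _)]mulrDr addrA.
  by rewrite (Hl (fun i => x 0 i)) -rmorphD /= addrA.
have E0 : \sum_i g i *~ (\row_i (c i)%:Z : 'rV[int]_r) 0 i = \sum_i g i *+ c i.
  by apply: eq_bigr => i _; rewrite mxE.
exists (\row_i (c i)%:Z, v); first by split=> [j|] /=; rewrite ?mxE // E0 -ey.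
rewrite /F /= /f; congr (_, _) => /=; first by rewrite E0.
have E : \sum_i lv i * (\row_i (c i)%:Z) 0 i = \sum_i lv i * (c i)%:Z.
  by apply: eq_bigr => i _; rewrite mxE.
rewrite E et; move: es; rewrite ey (Hl (fun i => (c i)%:Z)) -rmorphD /= => /intr_inj ->.
by rewrite -addrA mulrDr addrA.
Qed.

Section DefStep.
Variable k : nat.
Hypothesis IHk : forall D, presburger D -> gsemisimple (fun x : 'rV[int]_k => D (toenv x)).

Definition integral_on (D : env -> Prop) (l : env -> rat) :=
  forall x, D x -> exists z : int, l x = z%:~R.

(** [R] is a construction over a variable domain; a test [C] of a decision tree cuts it into two
    disjoint parts. This is the inductive step for end points given by trees, and the reason why [D]
    stays general there. *)
Lemma gsemisimple_split (R : (env -> Prop) -> 'rV[int]_k * int -> Prop) D C :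
  (forall D z, R D z -> D (toenv z.1)) ->
  (forall z, R D z <-> R (fun x => D x /\ C x) z \/ R (fun x => D x /\ ~ C x) z) ->
  gsemisimple (R (fun x => D x /\ C x)) -> gsemisimple (R (fun x => D x /\ ~ C x)) -> gsemisimple (R D).
Proof.
move=> RD e s1 s2; apply: (@gsemisimple_ext _ (fun z => _ \/ _)); first by move=> z; exact: iff_sym (e z).
by apply: gsemisimple_or => // z /RD[_ c] /RD[].
Qed.

Lemma gsemisimple_lower (N t0 : int) l : N != 0 -> pwpoly 1 l -> forall D, presburger D -> integral_on D l ->
  gsemisimple (fun z : 'rV[int]_k * int => D (toenv z.1) /\
    exists s : int, z.2 = t0 + N * s /\ l (toenv z.1) <= s%:~R).
Proof.
move=> N0; elim=> {l} [l pl|C l1 l2 l dC _ IH1 _ IH2 e1 e2] D dD lD; last first.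
  have := @gsemisimple_split (fun D z => D (toenv z.1) /\
    exists s : int, z.2 = t0 + N * s /\ l (toenv z.1) <= s%:~R) D C; apply.
  - by move=> D' z [].
  - move=> z; case: (classic (C (toenv z.1))); tauto.
  - apply: gsemisimple_ext (IH1 _ (presburger_and dD dC) _) => [z|x [/lD[z ez] /e1 <-]]; last by exists z.
    by split=> -[[a b] [s [es ls]]]; split=> //; exists s; rewrite e1 // in ls *.
  - apply: gsemisimple_ext (IH2 _ (presburger_and dD (presburger_not dC)) _) => [z|x [/lD[z ez] /e2 <-]]; last by exists z.
    by split=> -[[a b] [s [es ls]]]; split=> //; exists s; rewrite e2 // in ls *.
have [I [P [sP disj cov]]] := IHk dD.
apply: (gsemisimple_union (S := fun i (z : 'rV[int]_k * int) => P i z.1 /\ exists v s : int,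
     [/\ z.2 = t0 + N * s, s%:~R = l (toenv z.1) + v%:~R & 0 <= v])).
- move=> i; apply: (@gsemisimple_fibered _ _ _ _ _ (fun _ v => 0 <= v)) => //.
    by move=> x Px; apply: lD; apply/cov; exists i.
  by move=> r p g _; exact: gsemisimple_orthant.
- by move=> i j z [h _] [h' _]; exact: disj h h'.
move=> z; rewrite cov; split=> [[[i Pi] [s [es ls]]]|[i [Pi [v [s [es ls v0]]]]]]; last first.
  by split; [exists i|exists s; split=> //; rewrite ls lerDl ler0z].
exists i; split=> //; have [m em] := lD (toenv z.1) ((cov _).2 (ex_intro _ i Pi)).
exists (s - m), s; split=> //; first by rewrite rmorphB /= em addrC subrK.
by move: ls; rewrite em ler_int subr_ge0.
Qed.

Lemma gsemisimple_between (N t0 : int) l u : N != 0 -> pwpoly 1 l -> pwpoly 1 u ->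
  forall D, presburger D -> integral_on D l -> integral_on D u -> (forall x, D x -> l x <= u x) ->
  gsemisimple (fun z : 'rV[int]_k * int => D (toenv z.1) /\
    exists s : int, [/\ z.2 = t0 + N * s, l (toenv z.1) <= s%:~R & s%:~R <= u (toenv z.1)]).
Proof.
move=> N0 Pl Pu; elim: Pl => {l} [l pl|C l1 l2 l dC _ IH1 _ IH2 e1 e2] D dD lD uD lu; last first.
  have := @gsemisimple_split (fun D z => D (toenv z.1) /\
    exists s : int, [/\ z.2 = t0 + N * s, l (toenv z.1) <= s%:~R & s%:~R <= u (toenv z.1)]) D C; apply.
  - by move=> D' z [].
  - move=> z; case: (classic (C (toenv z.1))); tauto.
  - apply: gsemisimple_ext (IH1 _ (presburger_and dD dC) _ _ _) => [z|x [/lD[z ez] /e1 <-]|x [/uD]//|x [/lu ? /e1 <-]//].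
      by split=> -[[a b] [s [es ls us]]]; split=> //; exists s; rewrite e1 // in ls *.
    by exists z.
  - apply: gsemisimple_ext (IH2 _ (presburger_and dD (presburger_not dC)) _ _ _) => [z|x [/lD[z ez] /e2 <-]|x [/uD]//|x [/lu ? /e2 <-]//].
      by split=> -[[a b] [s [es ls us]]]; split=> //; exists s; rewrite e2 // in ls *.
    by exists z.
elim: Pu D dD lD uD lu => {u} [u pu|C u1 u2 u dC _ IH1 _ IH2 e1 e2] D dD lD uD lu; last first.
  have := @gsemisimple_split (fun D z => D (toenv z.1) /\
    exists s : int, [/\ z.2 = t0 + N * s, l (toenv z.1) <= s%:~R & s%:~R <= u (toenv z.1)]) D C; apply.
  - by move=> D' z [].
  - move=> z; case: (classic (C (toenv z.1))); tauto.
  - apply: gsemisimple_ext (IH1 _ (presburger_and dD dC) _ _ _) => [z|x [/lD]//|x [/uD[z ez] /e1 <-]|x [/lu ? /e1 <-]//].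
      by split=> -[[a b] [s [es ls us]]]; split=> //; exists s; rewrite e1 // in us *.
    by exists z.
  - apply: gsemisimple_ext (IH2 _ (presburger_and dD (presburger_not dC)) _ _ _) => [z|x [/lD]//|x [/uD[z ez] /e2 <-]|x [/lu ? /e2 <-]//].
      by split=> -[[a b] [s [es ls us]]]; split=> //; exists s; rewrite e2 // in us *.
    by exists z.
have [I [P [sP disj cov]]] := IHk dD.
apply: (gsemisimple_union (S := fun i (z : 'rV[int]_k * int) => P i z.1 /\ exists v s : int,
     [/\ z.2 = t0 + N * s, s%:~R = l (toenv z.1) + v%:~R &
         0 <= v /\ v%:~R <= u (toenv z.1) - l (toenv z.1)])).
- move=> i.
  apply: (@gsemisimple_fibered _ _ _ _ _ (fun x v => 0 <= v /\ v%:~R <= u (toenv x) - l (toenv x))) => //.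
    by move=> x Px; apply: lD; apply/cov; exists i.
  move=> r p g Bc.
  have Dc c : D (toenv (p + \sum_i g i *+ c i)) by apply/cov; exists i.
  have [l0 [lv Hl]] := polyfun1_param pl (fun c => lD _ (Dc c)).
  have [u0 [uv Hu]] := polyfun1_param pu (fun c => uD _ (Dc c)).
  have Hul (c : 'I_r -> int) : u (toenv (p + \sum_i g i *~ c i)) - l (toenv (p + \sum_i g i *~ c i))
      = ((u0 - l0) + \sum_i (uv i - lv i) * c i)%:~R.
    rewrite Hl Hu -rmorphB /= opprD addrACA -sumrB; congr (_ + _)%:~R.
    by apply: eq_bigr => j _; rewrite mulrBl.
  (* Since l <= u on the whole simple piece, u - l has nonnegative coefficients in the parameters,
     as [gsemisimple_below] requires. *)
  have [|h00 hv0] := @affine_nat_ge0 r (u0 - l0) (fun i => uv i - lv i).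
    by move=> c; rewrite -(ler0z rat) -Hul subr_ge0; exact: lu (Dc c).
  apply: gsemisimple_ext (gsemisimple_below (absz (u0 - l0)%R) (fun i => absz (uv i - lv i)%R)) => -[x v] /=.
  rewrite (Hul (fun i => x 0 i)) ler_int gez0_abs //.
  under eq_bigr => j _ do rewrite gez0_abs //.
  by split=> [[]|[? []]].
- by move=> i j z [h _] [h' _]; exact: disj h h'.
move=> z; rewrite cov; split=> [[[i Pi] [s [es ls us]]]|[i [Pi [v [s [es ls [v0 vu]]]]]]]; last first.
  split; [by exists i|exists s; split=> //; rewrite ls ?lerDl ?ler0z //].
  by rewrite addrC -lerBrDr.
exists i; split=> //; have [m em] := lD (toenv z.1) ((cov _).2 (ex_intro _ i Pi)).
exists (s - m), s; split=> //; first by rewrite rmorphB /= em addrC subrK.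
by move: ls; rewrite rmorphB /= em ler_int subr_ge0 lerD2r.
Qed.

Lemma gsemisimple_itv (N t0 : int) D L U : N != 0 -> presburger D -> opt_pwlinear L -> opt_pwlinear U ->
  gsemisimple (fun z : 'rV[int]_k * int => exists s, z.2 = t0 + N * s /\
    [/\ D (toenv z.1), opt_lower L (toenv z.1) s & opt_upper U (toenv z.1) s]).
Proof.
move=> N0 dD; have int_on (g : env -> int) D' : integral_on D' (fun x => (g x)%:~R).
  by move=> x _; exists (g x).
have lower M (g : env -> int) : M != 0 -> pwlinear g -> gsemisimple (fun z : 'rV[int]_k * int =>
    exists s, z.2 = t0 + M * s /\ (D (toenv z.1) /\ g (toenv z.1) <= s)).
  move=> M0 Pg; apply: gsemisimple_ext (gsemisimple_lower t0 M0 Pg dD (int_on g D)) => z.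
  split=> [[Dz [s [es]]]|[s [es [Dz gs]]]]; first by rewrite ler_int; exists s.
  by split=> //; exists s; rewrite ler_int.
have upper (g : env -> int) : pwlinear g -> gsemisimple (fun z : 'rV[int]_k * int =>
    exists s, z.2 = t0 + N * s /\ (D (toenv z.1) /\ s <= g (toenv z.1))).
  (* An upper bound on s is a lower bound on - s; the sign moves into the step of the progression,
     which may be negative. *)
  move=> Pg; have N0' : - N != 0 by rewrite oppr_eq0.
  apply: gsemisimple_ext (lower (- N) (fun x => -1 * g x) N0' (pwlinearZ _ Pg)) => z.
  split=> -[s [es [Dz gs]]]; exists (- s).
    by rewrite mulrN -mulNr; split=> //; split=> //; rewrite lerNl -mulN1r.
  by rewrite mulrNN; split=> //; split=> //; rewrite mulN1r lerN2.
case: L => [l|]; case: U => [u|] /= Pl Pu.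
- have Pl' : pwpoly 1 (fun x => (l x)%:~R) := Pl.
  have := gsemisimple_between t0 N0 Pl Pu (presburger_and dD (presburger_pwlinear_le Pl Pu)) (int_on _ _) (int_on _ _).
  move=> H; apply: gsemisimple_ext (H _) => [z|x [_]]; last by rewrite ler_int.
  split=> [[[Dz lu] [s [es]]]|[s [es [Dz ls us]]]]; first by rewrite !ler_int; exists s.
  split; first by split=> //; exact: le_trans us.
  by exists s; rewrite !ler_int.
- by apply: gsemisimple_ext (lower N l N0 Pl) => z; split=> -[s [es]] H; exists s; split=> //; case: H.
- by apply: gsemisimple_ext (upper u Pu) => z; split=> -[s [es]] H; exists s; split=> //; case: H.
- have Z : pwlinear (fun=> 0) by exact: pwpoly_const.
  have Z1 : pwlinear (fun=> -1) by exact: pwpoly_const.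
  (* A progression without bounds is cut into s >= 0 and s <= -1. *)
  apply: gsemisimple_ext (gsemisimple_or (lower N _ N0 Z) (upper _ Z1) _) => z.
    split=> [[[s [es [Dz _]]]|[s [es [Dz _]]]]|[s [es [Dz _ _]]]]; try by exists s.
    by case: (lerP 0 s) => s0; [left|right]; exists s; split=> //; split=> //; lia.
  move=> [s [es [_ s0]]] [s' [es' [_ s0']]].
  have /addrI/(mulfI N0) e : t0 + N * s = t0 + N * s' by rewrite -es.
  by move: s0; rewrite e; lia.
Qed.

(** The atoms inside [S] are disjoint, and over the first k coordinates each is an interval family
    in the last one; [F] identifies the pairs with rows of length k + 1. *)
Lemma gsemisimple_presburger_succ S : presburger S -> gsemisimple (fun x : 'rV[int]_k.+1 => S (toenv x)).
Proof.
move=> /(presburger_pwpoly_same_atom k) /(_ (pwpoly_const 0 0))[A [N [n [N0 kn HS _]]]].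
have Nz : N%:Z != 0 by rewrite eqz_nat -lt0n.
have [K [key keyP]] := same_atom_key A n N0.
pose f (z : 'rV[int]_k * int) : 'rV[int]_k.+1 := \row_i upd (toenv z.1) k z.2 i.
have fadd : zmod_morphism f.
  move=> [x u] [y v]; apply/rowP => i; rewrite !mxE /upd /=; case: eqP => // _.
  by rewrite /toenv; case: insub => [j|] /=; rewrite ?subrr // !mxE.
pose F := HB.pack_for {additive _ -> _} f (GRing.isZmodMorphism.Build _ _ f fadd).
have Fenv z : toenv (F z) = upd (toenv z.1) k z.2.
  apply: functional_extensionality => l; case: (ltnP l k.+1) => lk.
    by rewrite -[l]/(val (Ordinal lk)) toenv_ord mxE.
  by rewrite toenv_ge // /upd gtn_eqF // toenv_ge // ltnW.
have Fsurj x : exists z, x = F z.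
  exists (\row_(i < k) toenv x i, toenv x k); apply/rowP => i; rewrite -!toenv_ord Fenv /upd /=.
  case: eqP => [->//|/eqP ik]; have lk : (i < k)%N by rewrite ltn_neqAle ik -ltnS ltn_ord.
  by rewrite -[val i]/(val (Ordinal lk)) [RHS]toenv_ord mxE.
have Finj : injective F.
  apply: raddf_inj => -[x u] e; have e' l : upd (toenv x) k u l = 0.
    rewrite -(Fenv (x, u)) e; case: (ltnP l k.+1) => lk; last exact: toenv_ge.
    by rewrite -[l]/(val (Ordinal lk)) toenv_ord mxE.
  congr (_, _); last by have := e' k; rewrite updE.
  by apply/rowP => i; have := e' i; rewrite /upd ltn_eqF // toenv_ord mxE.
apply: (gsemisimple_union (S := fun (kk : K) x => key (toenv x) = kk /\ exists2 y, key y = kk & S y)).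
- move=> kk; case: (classic (exists2 y, key y = kk & S y)) => [[y <- Sy]|n0]; last first.
    by apply: gsemisimple_empty => x [].
  have [D [L [U [dD PL PU H]]]] := same_atom_cell A y N0 kn.
  apply: gsemisimple_ext (gsemisimple_image 0 Finj (gsemisimple_itv (y k) Nz dD PL PU)) => x.
  split=> [[[x' t] [s [/= -> /H c]] ->]|[/keyP c _]].
    by rewrite add0r Fenv; split; [exact/keyP|exists y].
  have [z ez] := Fsurj x; rewrite ez Fenv in c.
  exists z; last by rewrite add0r.
  have [s es] := same_atom_upd_dvd kn c; exists s; split=> //; apply/H; by rewrite -es.
- by move=> a b x [<- _] [].
move=> x; split=> [Sx|[kk [<- [y /keyP s Sy]]]]; last exact: HS s Sy.
by exists (key (toenv x)); split=> //; exists (toenv x).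
Qed.
End DefStep.

Lemma gsemisimple_presburger k S : presburger S -> gsemisimple (fun x : 'rV[int]_k => S (toenv x)).
Proof.
elim: k S => [|k IH] S dS; last exact: gsemisimple_presburger_succ.
case: (classic (S (toenv (0 : 'rV_0)))) => S0; last first.
  by apply: gsemisimple_empty => x; rewrite (thinmx0 x).
apply: gsimple_gsemisimple; exists 0, 0%N, (fun=> 0); split=> [c _ []//|x].
by rewrite (thinmx0 x); split=> // _; exists (fun=> 0%N); rewrite big_ord0 addr0.
Qed.

Lemma polyfun_mpoly k e h : polyfun e h -> exists2 p : {mpoly rat[k]}, (msize p <= e.+1)%N &
  forall x : 'rV[int]_k, h (toenv x) = p.@[fun i => (x 0 i)%:~R].
Proof.
elim=> {e h} [c|e f g _ [p sp ep] _ [q sq eq]|e f l _ [p sp ep]|e f _ [p sp ep]].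
- by exists c%:MP => [|x]; rewrite ?mevalC // msizeC; case: (c == 0).
- exists (p + q) => [|x]; last by rewrite mevalD ep eq.
  by apply: leq_trans (msizeD_le _ _) _; rewrite geq_max sp.
- case: (ltnP l k) => lk; last first.
    by exists 0 => [|x]; rewrite ?msize0 // meval0 toenv_ge // mul0r.
  exists ('X_(Ordinal lk) * p) => [|x]; last first.
    by rewrite mevalM mevalXU -ep -toenv_ord.
  have [->|pz] := eqVneq p 0; first by rewrite mulr0 msize0.
  have sX : msize ('X_(Ordinal lk) : {mpoly rat[k]}) = 2%N.
    by have := @msizeX k rat U_(Ordinal lk)%MM; rewrite mdeg1.
  by rewrite msizeM ?sX // -msize_poly_eq0 sX.
- by exists p => //; apply: leq_trans sp _.
Qed.

(** * Piecewise quasipolynomials *)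

(* The polyhedra are the sign patterns of the forms. The polynomial of a coset is chosen by [epsilon]
   from a predicate that depends only on the coset. *)
Lemma pwpoly_piecewise k e g (T : 'rV[int]_k -> Prop) (gT : 'rV[int]_k -> rat) : pwpoly e g ->
  (forall n, T n -> gT n = g (toenv n)) -> piecewise_quasipoly e T gT.
Proof.
move=> /pwpoly_same_atom[A [N [n [N0 H]]]] eT.
pose z0 : affine_form := exist _ _ (affine_const 0).
have /fin_all_exists[b /fin_all_exists[a Hab]] (j : 'I_(size A)) :
    exists b (a : 'I_k -> int), forall x, sval (nth z0 A j) (toenv x) = b + \sum_i a i * x 0 i.
  by apply: affine_toenv; exact: proj2_sig.
pose sg (s : {ffun 'I_(size A) -> bool}) (x : 'rV[int]_k) :=
  forall j : 'I_(size A), (0 <= sval (nth z0 A j) (toenv x)) = s j.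
pose cls s (x y : 'rV[int]_k) := sg s y /\ forall l, (N %| (y 0 l - x 0 l)%R)%Z.
pose Pr s x (p : {mpoly rat[k]}) := (msize p <= e.+1)%N /\
  forall y, cls s x y -> g (toenv y) = p.@[fun i => (y 0 i)%:~R].
pose P s x := epsilon (inhabits 0) (Pr s x).
have cls_sim s x y y' : cls s x y -> cls s x y' -> same_atom A N n (toenv y') (toenv y).
  move=> [sy my] [sy' my']; split.
    apply/(all_nthP z0) => j jA; have:= sy (Ordinal jA); have := sy' (Ordinal jA).
    by rewrite /= => -> ->.
  move=> l _; case: (ltnP l k) => lk; last by rewrite !toenv_ge // subrr.
  rewrite -[l]/(val (Ordinal lk)) !toenv_ord.
  have -> : y' 0 (Ordinal lk) - y 0 (Ordinal lk) =
    (y' 0 (Ordinal lk) - x 0 (Ordinal lk)) - (y 0 (Ordinal lk) - x 0 (Ordinal lk)) by ring.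
  by apply: rpredB; [exact: my'|exact: my].
have pwpoly_spec s x : Pr s x (P s x).
  apply: epsilon_spec; case: (classic (exists y, cls s x y)) => [[y cy]|n0]; last first.
    by exists 0; split=> [|y cy]; [rewrite msize0|case: n0; exists y].
  have [h ph eh] := H (toenv y); have [p sp ep] := polyfun_mpoly k ph.
  by exists p; split=> // y' cy'; rewrite eh ?ep //; exact: cls_sim cy cy'.
pose Am (s : {ffun 'I_(size A) -> bool}) : 'M[rat]_(size A, k) :=
  \matrix_(j, l) (if s j then - (a j l) else a j l)%:~R.
(* A negative integer form is at most -1, so both signs give closed half-spaces. *)
pose bm (s : {ffun 'I_(size A) -> bool}) : 'cV[rat]_(size A) :=
  \col_j (if s j then b j else - 1 - b j)%:~R.
have polyfun_sg s x : in_polyhedron (Am s) (bm s) x <-> sg s x.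
  have E (j : 'I_(size A)) : (\sum_l Am s j l * (x 0 l)%:~R <= bm s j 0) =
      ((0 <= sval (nth z0 A j) (toenv x)) == s j).
    under eq_bigr => l _ do rewrite mxE -rmorphM.
    have aux1 (S B : int) : (- S <= B) = ((0 <= B + S) == true) by lia.
    have aux2 (S B : int) : (S <= - 1 - B) = ((0 <= B + S) == false) by lia.
    rewrite -rmorph_sum mxE ler_int Hab; case: (s j); last exact: aux2.
    by under eq_bigr => l _ do rewrite mulNr; rewrite sumrN aux1.
  by split=> h j; [have := h j; rewrite E => /eqP|rewrite E h].
pose I : finType := {ffun 'I_(size A) -> bool}; pose S (al : 'I_#|I|) : I := enum_val al.
exists #|I|, (fun=> size A), (fun al => Am (S al)), (fun al => bm (S al)),
  (fun al (x : 'rV[int]_k) => (P (S al) x).@[fun i => (x 0 i)%:~R]); split; last split.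
- move=> x; exists (enum_rank [ffun j : 'I_(size A) => 0 <= sval (nth z0 A j) (toenv x)]).
  by apply/polyfun_sg; rewrite /S enum_rankK => j; rewrite ffunE.
- move=> al; exists (N%:Z)%:M, (P (S al)); split; last split; last split.
  + by rewrite det_scalar expf_neq0 // eqz_nat -lt0n.
  + move=> x x' [c]; rewrite mul_mx_scalar => exx'; rewrite /P; congr epsilon.
    have cE y : cls (S al) x y <-> cls (S al) x' y.
      have d l : (N %| (x 0 l - x' 0 l)%R)%Z.
        by have := congr1 (fun u : 'rV_k => u 0 l) exx'; rewrite !mxE => ->; rewrite dvdz_mulr.
      split=> -[sy m]; split=> // l.
        by rewrite -(subrK (x 0 l) (y 0 l)) -addrA rpredD.
      rewrite -(subrK (x' 0 l) (y 0 l)) -addrA rpredD // -opprB rpredN; exact: d.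
    apply: functional_extensionality => p; apply: propositional_extensionality.
    by split=> -[sp Hp]; split=> // y /cE; exact: Hp.
  + by move=> x; have [] := pwpoly_spec (S al) x.
  + by [].
- move=> al x /polyfun_sg sx /eT ->; have [_] := pwpoly_spec (S al) x; apply.
  by split=> // l; rewrite subrr.
Qed.

Lemma semisimple_presburger k (S : 'rV[int]_k -> Prop) : semisimple S ->
  presburger (fun y => S (\row_(l < k) y l)).
Proof.
case=> m [P [sP [_ cov]]].
apply: (@presburger_ext (fun y => exists i, P i (\row_(l < k) y l))); first by move=> y; rewrite cov.
apply: presburger_exT => i; have [p [r [g [_ H]]]] := sP i.
(* The coefficients of the generators are held in the variables k, ..., k + r - 1 and then projected
   away. *)
pose T (z : env) := (forall i : 'I_r, 0 <= z (k + i)%N) /\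
   forall l : 'I_k, z l = p 0 l + \sum_(i < r) g i 0 l * z (k + i)%N.
have dT : presburger T.
  apply: presburger_and; apply: presburger_allT => l; first exact: presburger_ge (affine_proj _).
  apply: presburger_eq; first exact: affine_proj.
  by apply: affine_add; [exact: affine_const|apply: affine_sum => j; exact: affine_var].
apply: presburger_ext (presburger_splice k r dT) => y; rewrite H.
have E3 (u : 'rV[int]_k) (a : nat) l : (u *+ a) 0 l = u 0 l * a%:Z.
  by rewrite -scaler_nat mxE mulrC natz.
have E1 s (l : 'I_k) : splice y k s l = y l by rewrite /splice leqNgt ltn_ord.
have E2 s (j : 'I_r) : size s = r -> splice y k s (k + j)%N = s`_j.
  by move=> sr; rewrite /splice leq_addr ltn_add2l sr ltn_ord addKn.
split=> [[s sr [s0 e]]|[c e]].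
  exists (fun j => absz s`_j); apply/rowP => l; rewrite !mxE -(E1 s) e summxE; congr (_ + _).
  by apply: eq_bigr => j _; have := s0 j; rewrite E2 // E3 => /gez0_abs ->.
exists (mktuple (fun j => (c j)%:Z)); first by rewrite size_tuple.
split=> [j|l]; first by rewrite E2 ?size_tuple // nth_mktuple.
rewrite E1; move/rowP/(_ l): e; rewrite !mxE => ->; congr (_ + _).
by rewrite summxE; apply: eq_bigr => j _; rewrite E2 ?size_tuple // nth_mktuple E3.
Qed.

Lemma presburger_splice_all k d S : presburger S ->
  presburger (fun x => forall s, size s = d -> S (splice x k s)).
Proof.
move=> dS; apply: presburger_ext (presburger_not (presburger_splice k d (presburger_not dS))) => x.
split=> [H s sd|H [s sd]]; last by apply; exact: H.
by apply: NNPP => nS; apply: H; exists s.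
Qed.

Lemma max_int_exists (P : int -> Prop) (M : int) : (exists m, P m) ->
  (forall m, P m -> m <= M) -> exists2 m, P m & forall m', P m' -> m' <= m.
Proof.
(* The greatest m is M - n for the least n passing this test. *)
move=> [m0 Pm0] PM; pose Q n := (if excluded_middle_informative (P (M - n%:Z)) then true else false).
have QP n : Q n <-> P (M - n%:Z) by rewrite /Q; case: excluded_middle_informative.
have exQ : exists n, Q n.
  exists (absz (M - m0)%R); apply/QP; rewrite gez0_abs ?subKr // subr_ge0; exact: PM.
case: (ex_minnP exQ) => n /QP Pn minn; exists (M - n%:Z) => // m' Pm'.
have leM := PM _ Pm'.
have /minn : Q (absz (M - m')%R) by apply/QP; rewrite gez0_abs ?subKr // subr_ge0.
lia.
Qed.

Lemma bounded_rows d (M : int) : exists s : seq 'rV[int]_d,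
  forall q : 'rV[int]_d, (forall j, - M <= q 0 j <= M) -> q \in s.
Proof.
pose N := absz M; exists [seq \row_j ((f j : nat)%:Z - M) | f : {ffun 'I_d -> 'I_(N + N).+1}].
move=> q qM; have lt j : (absz (q 0 j + M)%R < (N + N).+1)%N by have := qM j; rewrite /N; lia.
apply/imageP; exists [ffun j => Ordinal (lt j)] => //; apply/rowP => j.
by rewrite mxE ffunE /=; have := qM j; lia.
Qed.

(** * Graded families *)

Section Family.
Variables (K : fieldType) (d k : nat) (V : 'rV[int]_k -> 'rV[int]_d -> vectType K).
Hypothesis HV : num_constructible V.

Definition rown (y : env) : 'rV[int]_k := \row_i y i.
Definition rowq (y : env) : 'rV[int]_d := \row_j y (k + j)%N.
Definition dimE (y : env) : nat := dimV V (rown y) (rowq y).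

Definition seqq (q : 'rV[int]_d) : seq int := mktuple (fun j => q 0 j).

Lemma size_seqq q : size (seqq q) = d.
Proof. by rewrite size_tuple. Qed.

Lemma rown_splice (x : 'rV[int]_k) s : rown (splice (toenv x) k s) = x.
Proof. by apply/rowP => i; rewrite mxE /splice leqNgt ltn_ord toenv_ord. Qed.

Lemma rowq_splice x s (j : 'I_d) : size s = d -> rowq (splice x k s) 0 j = s`_j.
Proof. by move=> sd; rewrite mxE /splice leq_addr ltn_add2l sd ltn_ord addKn. Qed.

Lemma rowq_seqq x q : rowq (splice x k (seqq q)) = q.
Proof. by apply/rowP => j; rewrite rowq_splice ?size_seqq // nth_mktuple. Qed.

Lemma seqq_row s : size s = d -> seqq (\row_(j < d) s`_j) = s.
Proof.
move=> sd; apply: (@eq_from_nth _ 0) => [|i]; rewrite size_seqq ?sd // => id.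
by rewrite -[i]/(val (Ordinal id)) nth_mktuple mxE.
Qed.

Lemma dimE_splice n q : dimE (splice (toenv n) k (seqq q)) = dimV V n q.
Proof. by rewrite /dimE rown_splice rowq_seqq. Qed.

(** The bound variable [k + d] lies just outside the block k, ..., k + d - 1 that holds q, so the
    two updates commute. *)
Lemma splice_upd (n : 'rV[int]_k) t s : size s = d ->
  splice (upd (toenv n) (k + d) t) k s = upd (splice (toenv n) k s) (k + d) t.
Proof.
move=> sd; apply: functional_extensionality => l; rewrite /splice /upd sd.
by case: eqP => [->|//]; rewrite ltnn andbF.
Qed.

Lemma dimE_upd y t : dimE (upd y (k + d) t) = dimE y.
Proof.
rewrite /dimE; congr (dimV V _ _); apply/rowP => i; rewrite !mxE /upd.
  by rewrite ltn_eqF // ltn_addr.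
by rewrite eqn_add2l ltn_eqF.
Qed.

Lemma presburger_strata : exists (m : nat) (D : 'I_m -> env -> Prop) (v : 'I_m -> nat),
  [/\ forall i, presburger (D i), forall y, exists i, D i y & forall i y, D i y -> dimE y = v i].
Proof.
case: HV => m [P [sP [_ [cov cst]]]].
pose D i (y : env) := P i (\row_(l < k + d) y l).
have E (y : env) : \row_(l < k + d) y l = row_mx (rown y) (rowq y).
  apply/rowP => l; rewrite mxE; case: (split_ordP l) => j ->.
    by rewrite row_mxEl mxE.
  by rewrite row_mxEr mxE.
have /fin_all_exists[v Hv] i : exists v, forall y, D i y -> dimE y = v.
  case: (classic (exists y, D i y)) => [[y Dy]|n0]; last by exists 0%N => y Dy; case: n0; exists y.
  exists (dimE y) => y' Dy'; rewrite /D E in Dy; rewrite /D E in Dy'.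
  exact: cst Dy' Dy.
exists m, D, v; split=> // [i|y]; first exact: semisimple_presburger.
exact: cov.
Qed.

Lemma presburger_supp : presburger (fun y => dimE y != 0%N).
Proof.
have [m [D [v [dD cov Hv]]]] := presburger_strata.
apply: presburger_ext (presburger_exT (fun i => presburger_and (dD i) (presburger_const (v i != 0%N)))) => y.
split=> [[i [/Hv ->]]//|]; have [i Di] := cov y.
by rewrite (Hv _ _ Di) => vi; exists i.
Qed.

Lemma pwpoly_dim : pwpoly 0 (fun y => (dimE y)%:R).
Proof.
have [m [D [v [dD cov Hv]]]] := presburger_strata.
apply: (pwpoly_cases (D := D) (h := fun i _ => (v i)%:R)) => //.
  by move=> i; exact: pwpoly_const.
by move=> i y /Hv ->.
Qed.

(** A box has finitely many integer points; this trades a quantifier over lists, which is not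
    Presburger, for one over an integer. *)
Lemma finite_lengthP n : finite_length V n <->
  exists M : int, forall q, dimV V n q != 0%N -> forall j, - M <= q 0 j <= M.
Proof.
split=> [[s Hs]|[M HM]]; last first.
  by have [s Hs] := bounded_rows d M; exists s => q /HM; exact: Hs.
exists (\sum_(q <- s) \sum_j `|q 0 j|) => q /Hs qs j.
rewrite -ler_norml (big_rem q) //= (bigD1 j) //=.
by rewrite -addrA lerDl addr_ge0 // sumr_ge0 // => *; rewrite sumr_ge0.
Qed.

Lemma forall_splice n (R : 'rV[int]_d -> Prop) :
  (forall q, dimV V n q != 0%N -> R q) <->
  (forall s, size s = d -> dimE (splice (toenv n) k s) != 0%N -> R (rowq (splice (toenv n) k s))).
Proof.
split=> [H s sd|H q dq]; first by rewrite /dimE rown_splice; exact: H.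
by have := H _ (size_seqq q); rewrite dimE_splice rowq_seqq; apply.
Qed.

Lemma semisimple_finite_length : semisimple (finite_length V).
Proof.
apply: gsemisimple_semisimple.
pose E y := dimE y != 0%N -> forall j : 'I_d, - y (k + d)%N <= y (k + j)%N /\ y (k + j)%N <= y (k + d)%N.
have dE : presburger E.
  apply: presburger_imp; first exact: presburger_supp.
  apply: presburger_allT => j; apply: presburger_and; apply: presburger_le; try exact: affine_proj.
  by apply: affine_ext (affine_var (-1) (k + d)) => y; rewrite mulN1r.
apply: gsemisimple_ext (gsemisimple_presburger k (presburger_ex (k + d) (presburger_splice_all k d dE))) => n.
rewrite finite_lengthP; split=> -[M HM]; exists M.
  apply/forall_splice => s sd ds j; have := HM s sd; rewrite splice_upd // => /(_ _ j).
  rewrite dimE_upd updE /upd eqn_add2l (ltn_eqF (ltn_ord j)) => /(_ ds)[h1 h2].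
  by rewrite mxE h1 h2.
move=> s sd; rewrite splice_upd // /E dimE_upd => ds j.
have /forall_splice/(_ s sd ds j) := HM; rewrite mxE updE /upd eqn_add2l (ltn_eqF (ltn_ord j)).
by move/andP.
Qed.

Lemma piecewise_length : piecewise_quasipoly d (finite_length V) (fun n => (length_of V n)%:R).
Proof.
have [w Pw Hw] := pwpoly_splice_sum d k presburger_supp pwpoly_dim.
apply: (pwpoly_piecewise Pw) => n [s0 Hs0].
rewrite /length_of; set Pr := (fun s : seq 'rV[int]_d => _).
have [us Hs] : Pr (epsilon (inhabits [::]) Pr).
  apply: epsilon_spec; exists (undup s0); split; first exact: undup_uniq.
  by move=> q /Hs0; rewrite mem_undup.
move: (epsilon _ _) us Hs => s us Hs.
(* The list chosen by [epsilon] may contain degrees with zero component; the summation lemma wants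
   the exact support, and the removed terms are 0. *)
rewrite (Hw _ (map seqq [seq q <- s | dimV V n q != 0%N])).
- rewrite big_map big_filter natr_sum [LHS](bigID (fun q => dimV V n q != 0%N)) /=.
  rewrite [X in _ + X]big1 ?addr0 => [|q /negbNE/eqP -> //].
  by apply: eq_bigr => q _; rewrite dimE_splice.
- rewrite map_inj_uniq ?filter_uniq // => q q' e.
  by rewrite -(rowq_seqq (toenv n) q) e rowq_seqq.
move=> t; split=> [/mapP[q]|[td dt]].
  by rewrite mem_filter => /andP[dq _] ->; rewrite size_seqq dimE_splice.
apply/mapP; exists (\row_(j < d) t`_j); last by rewrite seqq_row.
have dq : dimV V n (\row_(j < d) t`_j) != 0%N by rewrite -dimE_splice seqq_row.
by rewrite mem_filter dq Hs.
Qed.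

Section Lambda.
Variable lam : 'rV[int]_d -> int.
Hypothesis lamD : forall x y, lam (x + y) = lam x + lam y.

Lemma lam_aff : affine (fun y => lam (rowq y)).
Proof.
have lam0 : lam 0 = 0 by apply: (addrI (lam 0)); rewrite -lamD !addr0.
have lamB : zmod_morphism lam.
  by move=> x y; apply: (addIr (lam y)); rewrite -lamD !subrK.
pose L := HB.pack_for {additive _ -> _} lam (GRing.isZmodMorphism.Build _ _ lam lamB).
apply: (@affine_ext (fun y => \sum_j lam (delta_mx 0 j) * y (k + j)%N)); last first.
  by apply: affine_sum => j; exact: affine_var.
move=> y; have -> : rowq y = \sum_j delta_mx 0 j *~ y (k + j)%N by rewrite sum_delta_row.
have -> : lam (\sum_j delta_mx 0 j *~ y (k + j)%N) = \sum_j lam (delta_mx 0 j *~ y (k + j)%N)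
  := raddf_sum L _ _ _.
apply: eq_bigr => j _; have -> : lam (delta_mx 0 j *~ y (k + j)%N) = lam (delta_mx 0 j) *~ y (k + j)%N
  := raddfMz L _ _.
by rewrite mulrzz.
Qed.

Definition is_max n (m : int) := (exists q, dimV V n q != 0%N /\ lam q = m) /\
  forall q, dimV V n q != 0%N -> lam q <= m.

(* The candidate upper bound is the variable just after the [k + d] coordinates of [(n, q)]. *)
Let ub y := dimE y != 0%N -> lam (rowq y) <= y (k + d)%N.

Lemma rowq_upd y t : rowq (upd y (k + d) t) = rowq y.
Proof. by apply/rowP => j; rewrite !mxE /upd eqn_add2l ltn_eqF. Qed.

Lemma presburger_ub : presburger (fun x => forall s, size s = d -> ub (splice x k s)).
Proof.
apply: presburger_splice_all; apply: presburger_imp; first exact: presburger_supp.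
by apply: presburger_le; [exact: lam_aff|exact: affine_proj].
Qed.

Lemma ubP n M : (forall s, size s = d -> ub (splice (upd (toenv n) (k + d) M) k s)) <->
  (forall q, dimV V n q != 0%N -> lam q <= M).
Proof.
rewrite (forall_splice n (fun q => lam q <= M)).
by split=> H s sd; have := H s sd; rewrite splice_upd // /ub dimE_upd rowq_upd updE.
Qed.

Lemma exists_splice n (R : 'rV[int]_d -> Prop) :
  (exists q, dimV V n q != 0%N /\ R q) <->
  (exists2 s, size s = d & dimE (splice (toenv n) k s) != 0%N /\ R (rowq (splice (toenv n) k s))).
Proof.
split=> [[q [dq Rq]]|[s sd]]; first by exists (seqq q); rewrite ?size_seqq // dimE_splice rowq_seqq.
by rewrite /dimE rown_splice => H; exists (rowq (splice (toenv n) k s)).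
Qed.

Lemma semisimple_Top : semisimple (Top_set V lam).
Proof.
apply: gsemisimple_semisimple.
have := gsemisimple_presburger k (presburger_and (presburger_splice k d presburger_supp) (presburger_ex (k + d) presburger_ub)).
apply: gsemisimple_ext => n; rewrite /Top_set; split=> -[h [M hM]]; split; try (by exists M; exact/ubP).
  have [|q []] := (exists_splice n (fun=> True)).2; last by exists q.
  by have [s] := h; exists s.
have [q dq] := h; have [|s sd []] := (exists_splice n (fun=> True)).1; last by exists s.
by exists q.
Qed.

Lemma is_max_uniq n m m' : is_max n m -> is_max n m' -> m = m'.
Proof.
move=> [[q [dq <-]] H] [[q' [dq' <-]] H']; apply/le_anti.
by rewrite H // H'.
Qed.

Lemma max_lamP n : Top_set V lam n -> is_max n (max_lam V lam n).
Proof.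
move=> [[q dq] [M HM]]; apply: epsilon_spec.
have [|m [q' dq']|m [q' [dq' <-]] Hm] :=
  @max_int_exists (fun m => exists q, dimV V n q != 0%N /\ lam q = m) M.
- by exists (lam q), q.
- by case: dq' => ? <-; exact: HM.
exists (lam q'); split; first by exists q'.
by move=> q'' dq''; apply: Hm; exists q''.
Qed.

(** Being the maximum is a Presburger condition on (n, m): m is attained and is an upper bound. The
    fibre over a point of [Top_set] is a single m, which [pwpoly_select] extracts. *)
Lemma pwpoly_max : exists2 g, pwpoly 1 g &
  forall n, Top_set V lam n -> (max_lam V lam n)%:~R = g (toenv n).
Proof.
pose S y := (exists2 s, size s = d & dimE (splice y k s) != 0%N /\ lam (rowq (splice y k s)) = splice y k s (k + d)%N)
  /\ forall s, size s = d -> ub (splice y k s).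
have dS : presburger S.
  apply: presburger_and presburger_ub; apply: (@presburger_splice k d (fun y => dimE y != 0%N /\ lam (rowq y) = y (k + d)%N)).
  apply: presburger_and; first exact: presburger_supp.
  by apply: presburger_eq; [exact: lam_aff|exact: affine_proj].
have SP n m : S (upd (toenv n) (k + d) m) <-> is_max n m.
  rewrite /S ubP /is_max (exists_splice n (fun q => lam q = m)).
  split=> -[[s sd h] hub]; split=> //; exists s => //; move: h;
    by rewrite splice_upd // dimE_upd rowq_upd updE.
have [g Pg Hg] := pwpoly_select (k + d) dS.
exists g => // n /max_lamP mx; apply/esym/Hg => t; split=> [/SP h|->]; last exact/SP.
exact: is_max_uniq h mx.
Qed.
End Lambda.
End Family.

Theorem theorem3p11 (K : fieldType) (d k : nat)
  (V : 'rV[int]_k -> 'rV[int]_d -> vectType K) :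
  num_constructible V ->
  (semisimple (finite_length V) /\
   piecewise_quasipoly d (finite_length V) (fun n => (length_of V n)%:R)) /\
  (forall lam : 'rV[int]_d -> int,
     (forall x y, lam (x + y) = lam x + lam y) ->
     semisimple (Top_set V lam) /\ semisimple (soc_set V lam) /\
     piecewise_quasilinear (Top_set V lam) (fun n => (max_lam V lam n)%:~R) /\
     piecewise_quasilinear (soc_set V lam) (fun n => (min_lam V lam n)%:~R)).
Proof.
move=> HV; split.
  by split; [exact: semisimple_finite_length|exact: piecewise_length].
(* Minima of lambda are negated maxima of - lambda, so the statements on soc follow from those on
   Top. *)
move=> lam lamD; pose nlam q := - lam q.
have nlamD x y : nlam (x + y) = nlam x + nlam y by rewrite /nlam lamD opprD.
have socE : soc_set V lam = Top_set V nlam.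
  apply: functional_extensionality => n; apply: propositional_extensionality.
  by split=> -[h [M HM]]; split=> //; exists (- M) => q /HM; rewrite /nlam lerNl ?opprK // lerN2.
have [g Pg Hg] := pwpoly_max HV lamD; have [g' Pg' Hg'] := pwpoly_max HV nlamD.
split; first exact: semisimple_Top.
split; first by rewrite socE; exact: semisimple_Top.
split; first exact: pwpoly_piecewise Pg Hg.
rewrite socE; apply: pwpoly_piecewise (pwpolyZ (-1) Pg') _ => n topn.
rewrite -Hg' // mulN1r -rmorphN; congr (_%:~R).
have [[q [dq eq]] mx] := max_lamP topn.
rewrite /min_lam; set Pr := (fun m : int => _).
have [[q' [dq' e']] mn] : Pr (epsilon (inhabits 0) Pr).
  apply: epsilon_spec; exists (- max_lam V nlam n); split.
    by exists q; split=> //; rewrite -eq opprK.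
  by move=> q' /mx; rewrite lerNl.
apply/le_anti/andP; split; first by rewrite -eq opprK mn.
by rewrite -e' lerNl mx.
Qed.
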